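(* Let $q\ge 2$ be a fixed integer and let $\bar\eta>0$ and $M>0$ be constants. Then there exist constants $c>0$ and $C>0$ (not depending on $n$ or $\Delta$) such that the following holds for all $\beta>0$, $\eta>0$ and $\Delta\ge 3$ with $\eta\le\bar\eta$ and $\beta\Delta\le M$. Let $G=(V,E)$ be an $n$-vertex graph of maximum degree $\Delta$, and let $\mu_{\mathrm{Potts}}$ be the Gibbs distribution of the $q$-state ferromagnetic Potts model on $G$ with parameter $\beta$. If $\mu_{\mathrm{Potts}}$ is $\eta$-spectrally independent, then the mixing time of the Swendsen--Wang dynamics satisfies $$T_{mix}(P_{SW})\le C\,(\Delta\log n)^{c}.$$ (That is: if $\eta=O(1)$ and $\beta\Delta=O(1)$, then $T_{mix}(P_{SW})=O((\Delta\log n)^c)$ for a constant $c>0$.)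
   Context: Potts model: for $G=(V,E)$, $\mathcal S=\{1,\dots,q\}$ and $\beta>0$, $\mu_{\mathrm{Potts}}(\sigma)=e^{-H(\sigma)}/Z$ for $\sigma\in\mathcal S^V$, where $H(\sigma)=-\beta\sum_{\{u,v\}\in E}\mathbf 1(\sigma_u=\sigma_v)$ and $Z$ is the normalizing constant. Swendsen--Wang (SW) dynamics $P_{SW}$: from $\sigma_t\in\mathcal S^V$, (1) for each edge $e=\{u,v\}\in E$ with $\sigma_t(u)=\sigma_t(v)$, independently include $e$ in $A_t$ with probability $p=1-e^{-\beta}$; (2) independently for each connected component $\mathcal C$ of $(V,A_t)$, draw a spin $s\in\{1,\dots,q\}$ uniformly at random and set $\sigma_{t+1}(v)=s$ for all $v\in\mathcal C$. It is ergodic and reversible with respect to $\mu_{\mathrm{Potts}}$. Mixing time: for an ergodic chain $P$ on $\Omega$ with stationary distribution $\mu$, $T_{mix}(P)=\min\{t>0:\max_{x\in\Omega}\|P^t(x,\cdot)-\mu\|_{TV}\le 1/4\}$. Spectral independence: let $\mu$ be a distribution on $\mathcal S^V$ with support $\Omega$. For $\Lambda\subseteq V$, a feasible pinning is $\tau\in\Omega_\Lambda=\{\tau\in\mathcal S^\Lambda:\mu(\sigma_\Lambda=\tau)>0\}$. Let $\Omega_u^\tau=\{s\in\mathcal S:\mu(\sigma_u=s\mid\sigma_\Lambda=\tau)>0\}$ and $\mathcal P^\tau=\{(u,s):u\in V\setminus\Lambda,\ s\in\Omega^\tau_u\}$. The signed pairwise influence matrix $\Psi^\tau_\mu\in\mathbb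 R^{\mathcal P^\tau\times\mathcal P^\tau}$ has entries $\Psi^\tau_\mu((u,a),(v,b))=\mu(\sigma_v=b\mid\sigma_u=a,\sigma_\Lambda=\tau)-\mu(\sigma_v=b\mid\sigma_\Lambda=\tau)$ for $u\ne v$ and $0$ if $u=v$. $\mu$ is $\eta$-spectrally independent if for every $\Lambda\subseteq V$ (with $V\setminus\Lambda\neq\emptyset$) and every $\tau\in\Omega_\Lambda$, the largest eigenvalue satisfies $\lambda_1(\Psi^\tau_\mu)\le\eta$. *)

(* Defs.v *)
From HB Require Import structures.
From mathcomp Require Import all_boot all_order all_algebra.
From mathcomp Require Import reals sequences exp.

Set Implicit Arguments.
Unset Strict Implicit.
Unset Printing Implicit Defensive.

Import Order.TTheory GRing.Theory Num.Theory.

Local Open Scope ring_scope.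

(* A simple graph on [V] is given by its edge set; an edge {u, v} is the
   two-element set [set u; v]. *)
Definition simple_graph (V : finType) (E : {set {set V}}) : Prop :=
  forall e : {set V}, e \in E -> #|e| = 2%N.

Definition degree (V : finType) (E : {set {set V}}) (v : V) : nat :=
  #|[set e in E | v \in e]|.

Definition max_degree (V : finType) (E : {set {set V}}) : nat :=
  \max_(v : V) degree E v.

(* Vertex sets of the connected components of (V, A). *)
Definition components (V : finType) (A : {set {set V}}) : {set {set V}} :=
  equivalence_partition (connect [rel u v | [set u; v] \in A]) [set: V].

Definition monochromatic (V S : finType) (sigma : {ffun V -> S})
    (e : {set V}) : bool :=
  [forall u in e, forall v in e, sigma u == sigma v].

Definition hamiltonian (R : realType) (V : finType) (q : nat) (beta : R)
    (E : {set {set V}}) (sigma : {ffun V -> 'I_q}) : R :=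
  - beta * \sum_(e in E) (monochromatic sigma e)%:R.

Definition partition_function (R : realType) (V : finType) (q : nat) (beta : R)
    (E : {set {set V}}) : R :=
  \sum_(sigma : {ffun V -> 'I_q}) expR (- hamiltonian beta E sigma).

Definition potts (R : realType) (V : finType) (q : nat) (beta : R)
    (E : {set {set V}}) (sigma : {ffun V -> 'I_q}) : R :=
  expR (- hamiltonian beta E sigma) / partition_function q beta E.

(* One step sums over the set A of retained monochromatic edges; given A, the
   factor of a component C is the probability that a uniform spin s agrees
   with tau on all of C. *)
Definition swendsen_wang (R : realType) (V : finType) (q : nat) (beta : R)
    (E : {set {set V}}) (sigma tau : {ffun V -> 'I_q}) : R :=
  let p := 1 - expR (- beta) in
  let mono := [set e in E | monochromatic sigma e] in
  \sum_(A : {set {set V}} | A \subset mono)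
    (\prod_(e in mono) (if e \in A then p else 1 - p)) *
    \prod_(C in components A)
      \sum_(s : 'I_q) q%:R^-1 * ([forall v in C, tau v == s])%:R.

Fixpoint kernel_pow (R : realType) (T : finType) (P : T -> T -> R) (t : nat)
    (x y : T) : R :=
  if t is t'.+1 then \sum_(z : T) P x z * kernel_pow P t' z y
  else (x == y)%:R.

Definition tv_dist (R : realType) (T : finType) (mu nu : T -> R) : R :=
  2^-1 * \sum_(x : T) `|mu x - nu x|.

Definition mixed_at (R : realType) (T : finType) (P : T -> T -> R)
    (mu : T -> R) (t : nat) : Prop :=
  \big[Num.max/0]_(x : T) tv_dist (kernel_pow P t x) mu <= 4^-1.

(* [t] is the minimum defining the mixing time of [P]. *)
Definition is_mixing_time (R : realType) (T : finType) (P : T -> T -> R)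
    (mu : T -> R) (t : nat) : Prop :=
  [/\ (0 < t)%N, mixed_at P mu t &
      forall s : nat, (0 < s)%N -> mixed_at P mu s -> (t <= s)%N].

Definition prob (R : realType) (T : finType) (mu : T -> R) (A : {set T}) : R :=
  \sum_(x in A) mu x.

Definition cond_prob (R : realType) (T : finType) (mu : T -> R)
    (A B : {set T}) : R :=
  prob mu (A :&: B) / prob mu B.

Definition spin_event (V S : finType) (u : V) (a : S) : {set {ffun V -> S}} :=
  [set sigma : {ffun V -> S} | sigma u == a].

Definition pin_event (V S : finType) (L : {set V})
    (tau : {ffun {v : V | v \in L} -> S}) : {set {ffun V -> S}} :=
  [set sigma : {ffun V -> S} | [forall v, sigma (val v) == tau v]].

Definition feasible_pairs (R : realType) (V S : finType)
    (mu : {ffun V -> S} -> R) (L : {set V})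
    (tau : {ffun {v : V | v \in L} -> S}) : {set V * S} :=
  [set us : V * S | (us.1 \notin L) &&
    (0 < cond_prob mu (spin_event us.1 us.2) (pin_event tau))].

Definition influence (R : realType) (V S : finType)
    (mu : {ffun V -> S} -> R) (L : {set V})
    (tau : {ffun {v : V | v \in L} -> S}) (x y : V * S) : R :=
  if x.1 == y.1 then 0
  else cond_prob mu (spin_event y.1 y.2)
         (spin_event x.1 x.2 :&: pin_event tau)
       - cond_prob mu (spin_event y.1 y.2) (pin_event tau).

Definition influence_mx (R : realType) (V S : finType)
    (mu : {ffun V -> S} -> R) (L : {set V})
    (tau : {ffun {v : V | v \in L} -> S}) :
    'M[R]_#|feasible_pairs mu tau| :=
  \matrix_(i, j) influence mu tau (enum_val i) (enum_val j).

(* The influence matrix is self-adjoint for the inner product with weights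
   mu(sigma_u = a | tau), so its spectrum is real and nonempty, and its largest
   eigenvalue is at most eta iff all its eigenvalues in [R] are. *)
Definition spectrally_independent (R : realType) (V S : finType)
    (mu : {ffun V -> S} -> R) (eta : R) : Prop :=
  forall (L : {set V}) (tau : {ffun {v : V | v \in L} -> S}),
    ~: L != set0 -> 0 < prob mu (pin_event tau) ->
    forall lambda : R, eigenvalue (influence_mx mu tau) lambda -> lambda <= eta.

(* Main.v *)
Require Import Defs.
From HB Require Import structures.
From mathcomp Require Import all_boot all_order all_algebra.
From mathcomp Require Import reals sequences exp.
From mathcomp Require Import ring lra zify.
From mathcomp Require complex.

(** Fix a strictly positive law [p] of spin configurations and let [mu] be the
    Potts measure. For a set [T] of vertices let [g T] be the entropy, relative to
    [mu], of the law under [p] of the spins in [T]. The proof shows that one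
    Swendsen-Wang step multiplies [g setT] by at most [1 - delta], where [1 / delta]
    is polynomial in the maximum degree and in [ln n].

    A step can be run as follows: open every edge of the graph independently with
    probability [1 - expR (- beta)], whatever the spins are; keep the open
    edges that are monochromatic; recolour the components of what is kept. Spins of
    vertices at which no edge is open are never looked at. Convexity of relative
    entropy and data processing therefore bound the new entropy by the mean of
    [g (~: isolated F)] over the set [F] of open edges ([relent_sw_step_le]). It
    remains to show that forgetting the spins of the isolated vertices loses, on
    average, a fraction [delta] of [g setT].

    Spectral independence enters through one inequality
    ([weakly_supermodular_relent]): summed over ordered pairs from a set of
    unpinned vertices, the second differences of [g] are at least [- K] times the
    sum of its first differences, where [K] depends on [q], [etabar] and [M] only.
    An induction turns this into [sum_marginal_gains_le], a form of entropic
    independence, and then into block factorizations: forgetting a random set that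
    contains each vertex independently with probability [theta] loses at least
    [theta ^+ K.+1] of the entropy ([bernoulli_removal_gain]), and in any block of
    [m] vertices some [K.+1] or fewer account for a fraction [m ^- K.+1] of the entropy
    of the block ([exists_small_removal]).

    The set of isolated vertices is not a product set, but for
    [theta = 1 / (2 k Delta)] with [k] of order [ln n] a product set of density
    [theta] has, with high probability, components of fewer than [k + 1] vertices
    ([bernoulli_not_shattered_le]). In each component pick the [K.+1] vertices
    above. They are all isolated with probability at least [expR (- M) ^+ K.+1],
    and by the Markov property of [mu] the losses from different components add
    up, so that linearity of expectation finishes the estimate
    ([isolated_removal_gain], [isolated_gain]).

    The entropy is linear in [n] after one step, hence order [ln n / delta] further
    steps make it smaller than [16^-1], and this forces total variation distance at
    most [4^-1] ([tv_dist_relent]). *)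

Set Implicit Arguments.
Unset Strict Implicit.
Unset Printing Implicit Defensive.

Import Order.TTheory GRing.Theory Num.Theory.

Local Open Scope ring_scope.

(** * Weakly supermodular set functions *)

(** Supermodularity would make every second difference nonnegative. Here their sum
    over ordered pairs may be negative, but only by [K] times the sum of the first
    differences. *)
Definition weakly_supermodular (R : realFieldType) (V : finType) (K : nat)
    (g : {set V} -> R) : Prop :=
  forall L U : {set V}, [disjoint L & U] ->
    - (K%:R * \sum_(u in U) (g (u |: L) - g L)) <=
    \sum_(u in U) \sum_(v in U | v != u)
      (g (v |: (u |: L)) - g (u |: L) - g (v |: L) + g L).

Section SetFunction.

Variables (R : realFieldType) (V : finType) (K : nat) (g : {set V} -> R).
Hypothesis g_super : weakly_supermodular K g.

(** For a supermodular [g] the constant would be 1. By induction on the size of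
    [B]: the claim for [B :\ u] on top of [u |: W], summed over [u], bounds the gains
    of [v] after [u], and weak supermodularity compares these with the gains of [v]
    alone. *)
Lemma sum_marginal_gains_le (W B : {set V}) : [disjoint W & B] ->
  \sum_(v in B) (g (v |: W) - g W) <= K.+1%:R * (g (W :|: B) - g W).
Proof.
have [n] := ubnP #|B|; elim: n => // n IHn in W B *; rewrite ltnS => leBn disWB.
have [->|[x Bx]] := set_0Vmem B; first by rewrite big_set0 setU0 subrr mulr0.
have n_gt0 : 0 < #|B|%:R :> R by rewrite ltr0n; apply/card_gt0P; exists x.
set t := _ - _; set s := \sum_(_ in _) _.
have step u : u \in B -> \sum_(v in B | v != u) (g (v |: (u |: W)) - g (u |: W))
    <= K.+1%:R * (t - (g (u |: W) - g W)).
  move=> Bu.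
  have -> : t - (g (u |: W) - g W) = g ((u |: W) :|: (B :\ u)) - g (u |: W).
    rewrite (_ : (u |: W) :|: (B :\ u) = W :|: B) /t; first ring.
    by apply/setP=> y; rewrite !inE; case: eqVneq => [->|]; rewrite ?Bu ?orbT.
  have:= IHn (u |: W) (B :\ u); rewrite (eq_bigl [pred v | (v \in B) && (v != u)]).
    apply.
      by rewrite (leq_trans _ leBn)// [#|B|](cardsD1 u) Bu.
    rewrite -setI_eq0; apply/eqP/setP=> y; rewrite !inE.
    case: eqVneq => //= _; apply/negbTE/negP=> /andP[Wy By].
    by have:= disjointFr disWB Wy; rewrite By.
  by move=> y; rewrite !inE andbC.
have := g_super disWB; rewrite -/s => loc.
have E1 : \sum_(u in B) \sum_(v in B | v != u)
      (g (v |: (u |: W)) - g (u |: W) - g (v |: W) + g W) =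
   \sum_(u in B) \sum_(v in B | v != u) (g (v |: (u |: W)) - g (u |: W))
   - (#|B|%:R - 1) * s.
  have -> : (#|B|%:R - 1) * s = \sum_(u in B) \sum_(v in B | v != u) (g (v |: W) - g W).
    transitivity (\sum_(u in B) (s - (g (u |: W) - g W))).
      by rewrite sumrB sumr_const -/s -mulr_natl; ring.
    by apply: eq_bigr => u Bu; rewrite /s (bigD1 u)//=; ring.
  rewrite -sumrB; apply: eq_bigr => u Bu; rewrite -sumrB.
  by apply: eq_bigr => v _; ring.
have E2 : \sum_(u in B) \sum_(v in B | v != u) (g (v |: (u |: W)) - g (u |: W))
   <= K.+1%:R * (#|B|%:R * t - s).
  have := ler_sum (index_enum V) step.
  by rewrite -mulr_sumr sumrB sumr_const -/s -[t *+ _]mulr_natl.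
rewrite -(ler_pM2l n_gt0).
move: loc E2; rewrite E1 -!natr1; move: (\sum_(u in B) _) => z.
by move: (#|B|%:R) => m; nra.
Qed.

(** The binomial coefficient is the number of [l]-subsets of [B] that contain a
    given set of [K.+1] elements: a random [T] of size [l] does as well as if the
    whole gain of [B] sat on [K.+1] elements. The induction reveals one element [v]
    of [B] at a time, and [sum_marginal_gains_le] says how much of the gain an
    average [v] takes away. *)
Lemma sum_removal_gains_ge (W B : {set V}) (l : nat) :
  [disjoint W & B] -> (K < l <= #|B|)%N ->
  'C(#|B| - K.+1, l - K.+1)%:R * (g (W :|: B) - g W) <=
  \sum_(T : {set V} | (T \subset B) && (#|T| == l))
    (g (W :|: B) - g (W :|: (B :\: T))).
Proof.
move=> disWB /andP[ltKl /subnKC]; move: (#|B| - l)%N => d.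
elim: d => [|d IHd] in W B disWB *; move=> cardB.
  have {cardB} cardB : l = #|B| by rewrite -cardB addn0.
  rewrite -cardB binn mul1r (big_pred1 B) ?setDv ?setU0// => T.
  rewrite /= eqEcard -cardB; case: (boolP (T \subset B)) => //= sTB.
  by rewrite eqn_leq cardB subset_leq_card.
set t := _ - _; pose f T := g (W :|: B) - g (W :|: (B :\: T)).
rewrite -[leRHS]/(\sum_(T : {set V} | (T \subset B) && (#|T| == l)) f T).
have n_gt0 : 0 < d.+1%:R :> R by rewrite ltr0n.
rewrite -(ler_pM2l n_gt0).
(* A subset of size l avoids d.+1 elements v of B. *)
have -> : d.+1%:R * \sum_(T : {set V} | (T \subset B) && (#|T| == l)) f T =
    \sum_(v in B) \sum_(T : {set V} | (T \subset B :\ v) && (#|T| == l)) f T.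
  rewrite mulr_sumr (exchange_big_dep
    (fun T : {set V} => (T \subset B) && (#|T| == l)))/=.
    apply: eq_bigr => T /andP[sTB /eqP cT].
    rewrite (eq_bigl [in B :\: T]); last first.
      by move=> v; rewrite !inE subsetD1 sTB cT eqxx/= andbC andbT.
    by rewrite sumr_const cardsD (setIidPr sTB) cT -cardB addKn mulr_natl.
  by move=> v T _; rewrite subsetD1 => /andP[/andP[-> _] ->].
have step v : v \in B -> 'C((l + d) - K.+1, l - K.+1)%:R * (t - (g (v |: W) - g W)) <=
   \sum_(T : {set V} | (T \subset B :\ v) && (#|T| == l)) f T.
  move=> Bv.
  have cB : (l + d)%N = #|B :\ v|.
    by apply/eqP; rewrite -eqSS -addnS cardB (cardsD1 v) Bv.
  have eU : (v |: W) :|: (B :\ v) = W :|: B.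
    by apply/setP=> y; rewrite !inE; case: eqVneq => [->|]; rewrite ?Bv ?orbT.
  have := IHd (v |: W) (B :\ v); rewrite -cB eU => IH.
  have -> : t - (g (v |: W) - g W) = g (W :|: B) - g (v |: W) by rewrite /t; ring.
  apply: le_trans (IH _ _) _ => //.
    rewrite -setI_eq0; apply/eqP/setP=> y; rewrite !inE.
    case: eqVneq => //= _; apply/negbTE/negP=> /andP[Wy By].
    by have:= disjointFr disWB Wy; rewrite By.
  apply: ler_sum => T /andP[]; rewrite subsetD1 => /andP[sTB nTv] _.
  rewrite /f (_ : v |: W :|: _ = W :|: (B :\: T))//.
  by apply/setP=> y; rewrite !inE; case: eqVneq => [->|]; rewrite ?Bv ?nTv ?orbT.
apply: (le_trans _ (ler_sum (index_enum V) step)).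
rewrite -mulr_sumr sumrB sumr_const -[t *+ _]mulr_natl -cardB.
have key : (d.+1%:R * 'C(l + d.+1 - K.+1, l - K.+1)%:R : R) =
    'C(l + d - K.+1, l - K.+1)%:R * ((l + d.+1)%:R - K.+1%:R).
  have -> : (l + d - K.+1 = (l + d.+1 - K.+1).-1)%N by lia.
  have -> : ((l + d.+1)%:R - K.+1%:R = (l + d.+1 - K.+1)%:R :> R).
    by rewrite natrB//; lia.
  rewrite -!natrM [in RHS]mulnC mul_bin_down.
  by congr (_ * _)%:R; lia.
rewrite mulrA key -mulrA ler_wpM2l// mulrBl.
by have := sum_marginal_gains_le disWB; rewrite -/t; lra.
Qed.

End SetFunction.

(** * Random removals *)

Lemma bin_leq_exp (n m : nat) : ('C(n, m) <= n ^ m)%N.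
Proof.
apply: (@leq_trans (n ^_ m)).
  by rewrite -bin_ffact leq_pmulr// fact_gt0.
elim: m => // m IHm; rewrite ffactnSr expnSr leq_mul// leq_subr.
by [].
Qed.

(** The case [l = K.+1] of [sum_removal_gains_ge] has coefficient 1, so the gain of
    [C] is at most the sum of the gains of its subsets of size [K.+1]; the best
    subset is as good as the average. *)
Lemma exists_small_removal (R : realFieldType) (V : finType) (K k : nat)
    (g : {set V} -> R) (X C : {set V}) :
  weakly_supermodular K g -> {homo g : A B / A \subset B >-> A <= B} ->
  (0 < k)%N -> C \subset X -> (#|C| <= k)%N ->
  exists T : {set V}, [/\ T \subset C, (#|T| <= K.+1)%N &
    g X - g (X :\: C) <= k%:R ^+ K.+1 * (g X - g (X :\: T))].
Proof.
move=> g_super g_mono k_gt0 sCX leCk.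
have k_ge1 : 1 <= k%:R ^+ K.+1 :> R by rewrite exprn_ege1// ler1n.
case: (leqP #|C| K.+1) => [smallC|bigC].
  exists C; split=> //; apply: ler_peMl => //.
  by rewrite subr_ge0 g_mono// subsetDl.
pose f (T : {set V}) := g X - g (X :\: T).
pose small := [pred T : {set V} | (T \subset C) && (#|T| == K.+1)].
have sum_ge : f C <= \sum_(T | small T) f T.
  have disj : [disjoint X :\: C & C].
    by rewrite -setI_eq0 setDE -setIA [_ :&: C]setIC setICr setI0.
  have := sum_removal_gains_ge g_super disj (l := K.+1).
  rewrite ltnS leqnn ltnW// subnn bin0 mul1r.
  have eU : X :\: C :|: C = X.
    by apply/setP=> y; rewrite !inE; have := subsetP sCX y;
       case: (y \in C) => //= [->|_]; rewrite ?orbT ?orbF.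
  rewrite eU => /(_ isT)/le_trans; apply.
  apply: ler_sum => T /andP[sTC _]; rewrite lerD2l lerN2 g_mono//.
  rewrite (_ : _ :|: _ = X :\: T)//; apply/setP=> y; rewrite !inE.
  have := subsetP sCX y; have := subsetP sTC y.
  by case: (y \in T) => //=; case: (y \in C) => //=; try (by move=> /(_ isT));
    move=> _; case: (y \in X) => //= /(_ isT).
have cardS : (#|small| <= k ^ K.+1)%N.
  rewrite -[#|small|]cardsE (_ : [set _ in _] =
    [set T : {set V} | T \subset C & #|T| == K.+1]).
    rewrite cards_draws; apply: leq_trans (bin_leq_exp _ _) _.
    by rewrite leq_exp2r.
  by apply/setP=> T; rewrite !inE.
have f_ge0 T : 0 <= f T by rewrite subr_ge0 g_mono// subsetDl.
case: (pickP small) => [T0 T0s|none]; last first.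
  exists set0; split; rewrite ?sub0set ?cards0// setD0 subrr mulr0.
  by apply: le_trans sum_ge _; rewrite big_pred0.
case: (arg_maxP f T0s) => T /andP[sTC /eqP cT] maxT; exists T; split; rewrite ?cT//.
apply: le_trans sum_ge _; apply: (@le_trans _ _ (\sum_(S | small S) f T)).
  by apply: ler_sum => S /maxT.
rewrite sumr_const -[f T *+ _]mulr_natl -natrX ler_wpM2r ?f_ge0//.
by rewrite ler_nat; apply: leq_trans cardS; rewrite leq_eqVlt; apply/orP; left;
  apply/eqP/eq_card.
Qed.

Section Bernoulli.

Variable R : realFieldType.

Definition bernoulli (T : finType) (D : {set T}) (theta : R) (F : {set T}) : R :=
  \prod_(x in D) (if x \in F then theta else 1 - theta).

(** All the probabilities of percolation events below are instances: an event that
    fixes the status of an element sets one of its two weights to 0. *)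
Lemma sum_prod_subsets (T : finType) (D : {set T}) (a b : T -> R) :
  \sum_(F : {set T} | F \subset D) \prod_(x in D) (if x \in F then a x else b x)
  = \prod_(x in D) (a x + b x).
Proof.
pose a' x := if x \in D then a x else 0; pose b' x := if x \in D then b x else 1.
transitivity (\prod_x (a' x + b' x)); last first.
  rewrite [RHS]big_mkcond; apply: eq_bigr => x _; rewrite /a' /b'.
  by case: (x \in D); rewrite ?add0r.
rewrite bigA_distr/= [RHS](bigID (fun F : {set T} => F \subset D))/=.
rewrite [X in _ + X]big1 ?addr0; last first.
  move=> F /subsetPn[x Fx nDx]; rewrite (bigD1 x)//= Fx /a' (negbTE nDx) mul0r.
  by [].
apply: eq_bigr => F sFD; rewrite [LHS]big_mkcond; apply: eq_bigr => x _.
by rewrite /a' /b'; case: (boolP (x \in D)) => // /(contra (subsetP sFD x))/negbTE ->.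
Qed.

Variables (T : finType) (D : {set T}) (theta : R).

Lemma bernoulli_sum : \sum_(F : {set T} | F \subset D) bernoulli D theta F = 1.
Proof.
by rewrite sum_prod_subsets big1// => x _; rewrite addrC subrK.
Qed.

Lemma bernoulli_contains (A : {set T}) : A \subset D ->
  \sum_(F : {set T} | (F \subset D) && (A \subset F)) bernoulli D theta F
  = theta ^+ #|A|.
Proof.
move=> sAD.
pose b x := if x \in A then 0 else 1 - theta.
transitivity (\prod_(x in D) (theta + b x)).
  rewrite -(sum_prod_subsets D (fun=> theta) b).
  rewrite [RHS](bigID (fun F : {set T} => A \subset F))/= [X in _ + X]big1 ?addr0.
    apply: eq_bigr => F /andP[_ sAF]; apply: eq_bigr => x _.
    by case: ifP => // nFx; rewrite /b ifN//; apply: contraFN nFx; apply: subsetP.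
  move=> F /andP[_ /subsetPn[x Ax nFx]].
  by rewrite (bigD1 x) ?(subsetP sAD)//= (negbTE nFx) /b Ax mul0r.
rewrite (bigID [in A])/= [X in _ * X]big1 ?mulr1; last first.
  by move=> x /andP[_ /negbTE nAx]; rewrite /b nAx addrC subrK.
rewrite (eq_bigl [in A]).
  rewrite -prodr_const; apply: eq_bigr => x Ax; by rewrite /b Ax addr0.
by move=> x /=; case: (boolP (x \in A)) => [/(subsetP sAD) ->|]; rewrite ?andbF.
Qed.

Lemma bernoulli_avoids (A : {set T}) : A \subset D ->
  \sum_(F : {set T} | (F \subset D) && [disjoint F & A]) bernoulli D theta F
  = (1 - theta) ^+ #|A|.
Proof.
move=> sAD.
pose a x := if x \in A then 0 else theta.
transitivity (\prod_(x in D) (a x + (1 - theta))).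
  rewrite -(sum_prod_subsets D a (fun=> 1 - theta)).
  rewrite [RHS](bigID (fun F : {set T} => [disjoint F & A]))/= [X in _ + X]big1 ?addr0.
    apply: eq_bigr => F /andP[_ dFA]; apply: eq_bigr => x _.
    by case: ifP => // Fx; rewrite /a (disjointFr dFA Fx).
  move=> F /andP[_ /pred0Pn[x /andP[/= Fx Ax]]].
  by rewrite (bigD1 x) ?(subsetP sAD)//= Fx /a Ax mul0r.
rewrite (bigID [in A])/= [X in _ * X]big1 ?mulr1; last first.
  by move=> x /andP[_ /negbTE nAx]; rewrite /a nAx addrC subrK.
rewrite (eq_bigl [in A]).
  rewrite -prodr_const; apply: eq_bigr => x Ax; by rewrite /a Ax add0r.
by move=> x /=; case: (boolP (x \in A)) => [/(subsetP sAD) ->|]; rewrite ?andbF.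
Qed.

Lemma bernoulli_ge0 (F : {set T}) : 0 <= theta <= 1 -> 0 <= bernoulli D theta F.
Proof.
move=> /andP[? ?]; apply: prodr_ge0 => x _.
by case: ifP; rewrite ?subr_ge0.
Qed.

End Bernoulli.

Lemma bernoulli_setT (R : realFieldType) (T : finType) (theta : R) (F : {set T}) :
  bernoulli setT theta F = theta ^+ #|F| * (1 - theta) ^+ (#|T| - #|F|).
Proof.
rewrite /bernoulli (bigID [in F])/=; congr (_ * _).
  rewrite (eq_bigl [in F]); last by move=> x; rewrite inE.
  by rewrite -prodr_const; apply: eq_bigr => x ->.
rewrite (eq_bigl [in ~: F]); last by move=> x; rewrite !inE.
rewrite (_ : (_ - _)%N = #|~: F|); last by rewrite [RHS]cardsCs setCK.
rewrite -prodr_const; apply: eq_bigr => x.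
by rewrite inE => /negbTE ->.
Qed.

Lemma sum_binomial_tail (R : comRingType) (theta : R) (n k : nat) : (k <= n)%N ->
  \sum_(l < n.+1 | (k <= l)%N)
    theta ^+ l * (1 - theta) ^+ (n - l) * 'C(n - k, l - k)%:R = theta ^+ k.
Proof.
move=> le_kn; have one : 1 = (1 - theta + theta) ^+ (n - k) by rewrite subrK expr1n.
rewrite -[RHS]mulr1 [X in _ = _ * X]one exprDn mulr_sumr -(big_mkord xpredT (fun i => theta ^+ k *
  ((1 - theta) ^+ (n - k - i) * theta ^+ i *+ 'C(n - k, i)))).
transitivity (\sum_(0 <= l < n.+1 | (k <= l)%N)
    theta ^+ l * (1 - theta) ^+ (n - l) * 'C(n - k, l - k)%:R).
  by rewrite big_mkord.
rewrite (big_cat_nat _ (n := k))//=; last by rewrite ltnW.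
rewrite big_nat_cond big_pred0 ?add0r; last first.
  by move=> i /=; case: ltnP; rewrite ?andbF.
rewrite -[X in \sum_(X <= _ < _ | _) _]add0n big_addn.
rewrite subSn// big_nat_cond [RHS]big_nat_cond.
apply: eq_big => i; first by rewrite !andbT leq_addl andbT.
move=> _; rewrite addnK (_ : n - (i + k) = n - k - i)%N; last by lia.
by rewrite exprD -mulr_natr; ring.
Qed.

(** Average [sum_removal_gains_ge] over the size of [S]; the resulting binomial sum
    is the probability [theta ^+ K.+1] that [S] contains a given set of [K.+1]
    elements. *)
Lemma bernoulli_removal_gain (R : realFieldType) (V : finType) (K : nat)
    (g : {set V} -> R) (theta : R) :
  weakly_supermodular K g -> {homo g : A B / A \subset B >-> A <= B} ->
  0 <= theta <= 1 ->
  theta ^+ K.+1 * (g setT - g set0) <=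
  \sum_(S : {set V}) bernoulli setT theta S * (g setT - g (~: S)).
Proof.
move=> g_super g_mono /andP[t_ge0 t_le1].
have f_ge0 S : 0 <= g setT - g (~: S) by rewrite subr_ge0 g_mono ?subsetT.
have w_ge0 S : 0 <= bernoulli setT theta S by rewrite bernoulli_ge0// t_ge0.
have g0 : 0 <= g setT - g set0 by rewrite subr_ge0 g_mono ?subsetT.
set n := #|V|.
(* With fewer than K.+1 vertices the term S = setT is already enough. *)
case: (ltnP n K.+1) => [smallV|bigV].
  rewrite (bigD1 setT)//= setCT bernoulli_setT cardsT subnn mulr1.
  rewrite -[leLHS]addr0 lerD//; last by apply: sumr_ge0 => S _; rewrite mulr_ge0.
  by rewrite ler_wpM2r// ler_wiXn2l// ltnW.
have le_n (S : {set V}) : (#|S| < n.+1)%N by rewrite ltnS max_card.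
rewrite (partition_big (fun S => Ordinal (le_n S)) xpredT)//=.
apply: (@le_trans _ _ (\sum_(l < n.+1 | (K < l)%N)
   theta ^+ l * (1 - theta) ^+ (n - l) * ('C(n - K.+1, l - K.+1)%:R * (g setT - g set0)))).
  rewrite (eq_bigr (fun l : 'I_n.+1 => (theta ^+ l * (1 - theta) ^+ (n - l) *
     'C(n - K.+1, l - K.+1)%:R) * (g setT - g set0))); last by move=> l _;
       rewrite !mulrA.
  rewrite -mulr_suml ler_wpM2r//.
  by rewrite sum_binomial_tail.
rewrite [leRHS](bigID (fun l : 'I_n.+1 => (K < l)%N))/=.
rewrite -[leLHS]addr0 lerD//; last first.
  by apply: sumr_ge0 => l _; apply: sumr_ge0 => S _; rewrite mulr_ge0.
apply: ler_sum => l ltKl.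
rewrite (eq_bigr (fun S => theta ^+ l * (1 - theta) ^+ (n - l) * (g setT - g (~: S)))).
  rewrite -mulr_sumr ler_wpM2l ?mulr_ge0 ?exprn_ge0 ?subr_ge0//.
  have disj : [disjoint set0 & [set: V]] by rewrite -setI_eq0 set0I.
  have := sum_removal_gains_ge g_super disj (l := l).
  rewrite ltKl cardsT -/n -ltnS ltn_ord set0U => /(_ isT) /le_trans; apply.
  rewrite le_eqVlt; apply/orP; left; apply/eqP; apply: eq_big => S.
    by rewrite subsetT.
  by rewrite set0U setTD.
by move=> S /eqP <-; rewrite bernoulli_setT.
Qed.

(** * Relative entropies of marginals *)

Section Agreement.

Variables V S : finType.
Implicit Types (A B T : {set V}) (s t : {ffun V -> S}).

Definition agree T s t : bool := [forall v in T, s v == t v].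

Lemma agreeP T s t : reflect {in T, forall v, s v = t v} (agree T s t).
Proof. exact: (iffP 'forall_in_eqP). Qed.

Lemma agree_refl T s : agree T s s.
Proof. exact/agreeP. Qed.

Lemma agree_sym T s t : agree T s t = agree T t s.
Proof. by apply/agreeP/agreeP => E v Tv; rewrite E. Qed.

Lemma agree_trans T t s u : agree T s t -> agree T t u -> agree T s u.
Proof. by move=> /agreeP E /agreeP F; apply/agreeP => v Tv; rewrite E// F. Qed.

Lemma agree_sub A B s t : A \subset B -> agree B s t -> agree A s t.
Proof. by move=> /subsetP AB /agreeP E; apply/agreeP => v /AB /E. Qed.

Lemma agreeU A B s t : agree (A :|: B) s t = agree A s t && agree B s t.
Proof.
apply/agreeP/andP => [E|[/agreeP E /agreeP F] v /setUP[/E|/F]//].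
by split; apply/agreeP => v H; apply: E; rewrite inE H ?orbT.
Qed.

Lemma agree0 s t : agree set0 s t.
Proof. by apply/agreeP => v; rewrite inE. Qed.

Lemma agreeT s t : agree setT s t = (s == t).
Proof. by apply/agreeP/eqP => [E|-> //]; apply/ffunP => v; rewrite E ?inE. Qed.

Lemma agree_eql T s t : agree T s t -> agree T s =1 agree T t.
Proof.
move=> st u; apply/idP/idP; first by apply: agree_trans; rewrite agree_sym.
exact: agree_trans.
Qed.

Definition depends_on (X : Type) T (h : {ffun V -> S} -> X) : Prop :=
  forall s t, agree T s t -> h s = h t.

Lemma depends_on_sub (X : Type) A B (h : {ffun V -> S} -> X) :
  A \subset B -> depends_on A h -> depends_on B h.
Proof. by move=> sAB hA s t /(agree_sub sAB); apply: hA. Qed.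

End Agreement.

Section Marginals.

Variables (R : realType) (V S : finType).
Implicit Types (p q : {ffun V -> S} -> R) (A B T Z : {set V}) (s t : {ffun V -> S}).

(** Marginals and densities are kept as functions of a full configuration, so that
    laws of spins on different sets of vertices can be multiplied and compared
    without changing type. *)
Definition marg p T s : R := \sum_(t | agree T s t) p t.

Definition density p q T s : R := marg p T s / marg q T s.

Definition relent p q T : R := \sum_s p s * ln (density p q T s).

Lemma marg_depends p T : depends_on T (marg p T).
Proof. by move=> s t /agree_eql E; apply: eq_bigl. Qed.

Lemma density_depends p q T : depends_on T (density p q T).
Proof. by move=> s t st; rewrite /density !(marg_depends _ st). Qed.

Lemma marg0 p s : marg p set0 s = \sum_t p t.
Proof. by apply: eq_bigl => t; rewrite agree0. Qed.

Lemma margT p s : marg p setT s = p s.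
Proof. by rewrite /marg (big_pred1 s)// => t; rewrite agreeT eq_sym. Qed.

Lemma marg_gt0 p T s : (forall t, 0 < p t) -> 0 < marg p T s.
Proof.
move=> p_gt0; rewrite /marg (bigD1 s) ?agree_refl//= ltr_wpDr//.
by apply: sumr_ge0 => t _; apply: ltW.
Qed.

Lemma density_gt0 p q T s :
  (forall t, 0 < p t) -> (forall t, 0 < q t) -> 0 < density p q T s.
Proof. by move=> p_gt0 q_gt0; rewrite divr_gt0// marg_gt0. Qed.

Lemma ln_ge1BV (x : R) : 0 < x -> 1 - x^-1 <= ln x.
Proof.
move=> x_gt0; have := @le_ln1Dx R (x^-1 - 1).
rewrite ltrBrDr addNr invr_gt0 => /(_ x_gt0).
by rewrite addrC subrK lnV ?posrE//; lra.
Qed.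

(** On functions of the spins in [T], the density of the marginals on [T] turns
    expectations under [p] into expectations under [q]. *)
Lemma change_of_measure p q T (h : {ffun V -> S} -> R) :
  (forall t, 0 < p t) -> depends_on T h ->
  \sum_s p s * (density q p T s * h s) = \sum_s q s * h s.
Proof.
move=> p_gt0 hT.
transitivity (\sum_s \sum_(t | agree T s t) p s / marg p T s * h s * q t).
  by apply: eq_bigr => s _; rewrite -mulr_sumr -/(marg q T s) /density; ring.
rewrite (exchange_big_dep xpredT)//=; apply: eq_bigr => t _.
have P0 : marg p T t != 0 by rewrite gt_eqF ?marg_gt0.
transitivity (\sum_(s | agree T s t) p s * (h t * q t / marg p T t)).
  apply: eq_bigr => s st; rewrite (marg_depends _ st) (hT _ _ st); ring.
rewrite -mulr_suml (eq_bigl (agree T t)); last by move=> s; rewrite agree_sym.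
by rewrite -/(marg p T t); field.
Qed.

Variables p q : {ffun V -> S} -> R.
Hypotheses (p_gt0 : forall t, 0 < p t) (q_gt0 : forall t, 0 < q t).
Hypotheses (sum_p : \sum_t p t = 1) (sum_q : \sum_t q t = 1).

Let P_gt0 T s : 0 < marg p T s. Proof. exact: marg_gt0. Qed.
Let Q_gt0 T s : 0 < marg q T s. Proof. exact: marg_gt0. Qed.
Let d_gt0 T s : 0 < density p q T s. Proof. exact: density_gt0. Qed.

Let densityV T s : (density p q T s)^-1 = density q p T s.
Proof. by rewrite /density invf_div. Qed.

Lemma relent0 : relent p q set0 = 0.
Proof.
rewrite /relent big1// => s _.
by rewrite /density !marg0 sum_p sum_q divr1 ln1 mulr0.
Qed.

Lemma relentT : relent p q setT = \sum_s p s * ln (p s / q s).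
Proof. by apply: eq_bigr => s _; rewrite /density !margT. Qed.

Lemma relentB T A : A \subset T ->
  relent p q T - relent p q A =
  \sum_s q s * (density p q T s * ln (density p q T s / density p q A s)).
Proof.
move=> sAT; rewrite change_of_measure//.
  by rewrite -sumrB; apply: eq_bigr => s _; rewrite ln_div ?posrE//; ring.
by move=> s t st; rewrite !(density_depends _ _ st, density_depends _ _ (agree_sub sAT st)).
Qed.

Lemma relent_mono : {homo relent p q : A B / A \subset B >-> A <= B}.
Proof.
move=> A B sAB; rewrite -subr_ge0.
apply: (@le_trans _ _ (\sum_s p s * (1 - density p q A s / density p q B s))).
  have -> : \sum_s p s * (1 - density p q A s / density p q B s) =
      \sum_s p s - \sum_s p s * (density q p B s * density p q A s).
    rewrite -sumrB; apply: eq_bigr => s _; rewrite -densityV; ring.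
  rewrite change_of_measure//; last exact: depends_on_sub sAB (@density_depends p q A).
  have := @change_of_measure q p A (fun=> 1) q_gt0 (fun _ _ _ => erefl).
  under eq_bigr do rewrite mulr1.
  by under [in RHS]eq_bigr do rewrite mulr1; move=> ->; rewrite subrr.
rewrite -sumrB; apply: ler_sum => s _; rewrite -mulrBr ler_wpM2l ?(ltW (p_gt0 s))//.
rewrite -ln_div ?posrE//; have := ln_ge1BV (divr_gt0 (d_gt0 B s) (d_gt0 A s)).
by rewrite invf_div.
Qed.

(** The right-hand side is the expectation under [p] of the logarithm of a ratio of
    densities; bound it below by [ln x >= 1 - x^-1] and pass from [p] to [q]. *)
Lemma relent_defect_ge A B Z : Z \subset A -> Z \subset B ->
  1 - \sum_s q s * (density p q A s * density p q B s / density p q Z s) <=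
  relent p q (A :|: B) - relent p q A - relent p q B + relent p q Z.
Proof.
move=> sZA sZB.
have sA : A \subset A :|: B by rewrite subsetUl.
have sB : B \subset A :|: B by rewrite subsetUr.
rewrite -(@change_of_measure p q (A :|: B)) ?sum_p -?{1}sum_p //; last first.
  move=> s t st; have stA := agree_sub sA st; have stB := agree_sub sB st.
  by rewrite (density_depends _ _ stA) (density_depends _ _ stB)
     (density_depends _ _ (agree_sub sZA stA)).
rewrite /relent -!sumrB -big_split/=; apply: ler_sum => s _.
rewrite -!mulrBr -mulrDr -{1}[p s]mulr1 -mulrBr ler_wpM2l ?(ltW (p_gt0 s))//.
rewrite -densityV.
move: (d_gt0 (A :|: B) s) (d_gt0 A s) (d_gt0 B s) (d_gt0 Z s).
move: (density p q _ s) (density p q _ s) (density p q _ s) (density p q _ s).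
move=> z b a u u_gt0 a_gt0 b_gt0 z_gt0.
have := ln_ge1BV (divr_gt0 (mulr_gt0 u_gt0 z_gt0) (mulr_gt0 a_gt0 b_gt0)).
rewrite ln_div ?posrE ?mulr_gt0// !lnM ?posrE// invf_div.
by rewrite (_ : u^-1 * _ = a * b / (u * z)); [lra|rewrite invfM; ring].
Qed.

(** Draw [t] from [p], then [w] from [p] conditioned to agree with [t] on [Z], and
    glue [w] on [A] to [t] on [B]. The sum is the probability that the two pieces are
    compatible. *)
Lemma sum_glued_marginals_le A B Z : Z \subset A -> Z \subset B ->
  \sum_s q s / marg q (A :|: B) s * (marg p A s * marg p B s / marg p Z s) <= 1.
Proof.
move=> sZA sZB.
have -> : \sum_s q s / marg q (A :|: B) s * (marg p A s * marg p B s / marg p Z s) =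
   \sum_t \sum_w p t * p w / marg p Z t *
      \sum_(s | agree A s w && agree B s t) q s / marg q (A :|: B) s.
  transitivity (\sum_s \sum_(t | agree B s t) \sum_(w | agree A s w)
     p t * p w / marg p Z t * (q s / marg q (A :|: B) s)).
    apply: eq_bigr => s _.
    transitivity (\sum_(t | agree B s t) p t * (q s / marg q (A :|: B) s * (marg p A s
      / marg p Z s))).
      by rewrite -mulr_suml -/(marg p B s); ring.
    apply: eq_bigr => t st; rewrite -(marg_depends _ (agree_sub sZB st)).
    transitivity (\sum_(w | agree A s w) p w * (p t / marg p Z s * (q s / marg q (A :|: B) s))).
      by rewrite -mulr_suml -/(marg p A s); ring.
    by apply: eq_bigr => w _; ring.
  rewrite (exchange_big_dep xpredT)//=; apply: eq_bigr => t _.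
  rewrite (exchange_big_dep xpredT)//=; apply: eq_bigr => w _.
  by rewrite -mulr_sumr; congr (_ * _); apply: eq_bigl => s; rewrite andbC.
rewrite -sum_p; apply: ler_sum => t _.
have P0 : marg p Z t != 0 by rewrite gt_eqF.
have pE : p t = \sum_(w | agree Z t w) p t * p w / marg p Z t.
  transitivity (\sum_(w | agree Z t w) p w * (p t / marg p Z t)).
    by rewrite -mulr_suml -/(marg p Z t); field.
  by apply: eq_bigr => w _; ring.
rewrite [leRHS]pE [leRHS]big_mkcond/=; apply: ler_sum => w _.
have c_ge0 : 0 <= p t * p w / marg p Z t by rewrite ltW// divr_gt0// mulr_gt0.
(* The configurations that extend both pieces are one class for A :|: B, if any. *)
case: (pickP (fun s => agree A s w && agree B s t)) => [s0 /andP[sw st]|none];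
  last first.
  by rewrite [X in _ * X]big_pred0// mulr0; case: ifP.
have -> : agree Z t w.
  rewrite (agree_trans (t := s0))//; last exact: agree_sub sw.
  by rewrite agree_sym (agree_sub sZB).
rewrite ler_piMr// (eq_bigl (agree (A :|: B) s0)); last first.
  move=> s; rewrite agreeU (agree_eql sw) (agree_eql st).
  by rewrite [agree A s w]agree_sym [agree B s t]agree_sym.
rewrite (eq_bigr (fun s => q s / marg q (A :|: B) s0)); last first.
  by move=> s s0s; rewrite (marg_depends _ s0s).
by rewrite -mulr_suml -/(marg q (A :|: B) s0) divff// gt_eqF.
Qed.

(** If under [q] the spins in [A] and [B] are independent given those in [Z], the
    correction term of [relent_defect_ge] is the sum of [sum_glued_marginals_le]. *)
Lemma relent_supermodular A B Z : Z \subset A -> Z \subset B ->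
  (forall s, marg q (A :|: B) s * marg q Z s = marg q A s * marg q B s) ->
  relent p q A + relent p q B <= relent p q (A :|: B) + relent p q Z.
Proof.
move=> sZA sZB indep.
have := relent_defect_ge sZA sZB.
suff : \sum_s q s * (density p q A s * density p q B s / density p q Z s) <= 1 by lra.
apply: le_trans (sum_glued_marginals_le sZA sZB).
rewrite le_eqVlt; apply/orP; left; apply/eqP; apply: eq_bigr => s _; rewrite /density.
have nz T r : (forall t, 0 < r t) -> marg r T s != 0 by move=> ?;
  rewrite gt_eqF ?marg_gt0.
transitivity (q s * (marg p A s * marg p B s / marg p Z s) *
  (marg q Z s / (marg q A s * marg q B s))); first by field; rewrite !nz.
by rewrite -indep; field; rewrite !nz.
Qed.

End Marginals.

(** * From bounded covariances to weak supermodularity *)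

Section LocalEntropy.

Variables (R : realType) (V S : finType).
Implicit Types (s t : {ffun V -> S}) (L U : {set V}).

(** Apply [ln y >= 1 - y^-1] to [y = Num.sqrt x]. *)
Lemma xlnx_ge_hellinger (x : R) : 0 < x -> (Num.sqrt x - 1) ^+ 2 <= x * ln x - x + 1.
Proof.
move=> x_gt0; have y_gt0 : 0 < Num.sqrt x by rewrite sqrtr_gt0.
have := ln_ge1BV y_gt0; move: (Num.sqrt x) (sqr_sqrtr (ltW x_gt0)) y_gt0 => y <- y_gt0.
rewrite lnXn// -mulr_natr -(ler_pM2l y_gt0) mulrBr divff ?gt_eqF// => lny.
have := ler_wpM2l (ltW y_gt0) lny.
set l := ln y; nra.
Qed.

(** Entropy controls variance for densities bounded by [m], because
    [(x - 1) ^+ 2 = (Num.sqrt x + 1) ^+ 2 * (Num.sqrt x - 1) ^+ 2] and the first factor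
    is at most [4 * m]. *)
Lemma xlnx_ge_sqr (m x : R) : 0 < x -> x <= m -> 1 <= m ->
  (x - 1) ^+ 2 <= 4 * m * (x * ln x - x + 1).
Proof.
move=> x_gt0 le_xm m_ge1.
have := xlnx_ge_hellinger x_gt0; set w := x * _ - x + 1 => hw.
have y_ge0 := sqrtr_ge0 x; have y2 := sqr_sqrtr (ltW x_gt0).
move: (Num.sqrt x) y_ge0 y2 hw => y y_ge0 y2 hw.
have -> : (x - 1) ^+ 2 = (y + 1) ^+ 2 * (y - 1) ^+ 2 by rewrite -y2; ring.
apply: ler_pM; rewrite ?sqr_ge0//.
by have := sqr_ge0 (y - 1); nra.
Qed.

(** The form in which spectral independence is used: under every pinning of [L], the
    sum of the covariances of centred functions of single spins is at most [eta]
    times the sum of their variances. *)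
Definition covariance_bounded (q : {ffun V -> S} -> R) (eta : R) : Prop :=
  forall L U (s0 : {ffun V -> S}) (phi : V -> S -> R), [disjoint L & U] ->
    (forall u, u \in U -> \sum_(s | agree L s0 s) q s * phi u (s u) = 0) ->
    \sum_(s | agree L s0 s) q s *
      (\sum_(u in U) \sum_(v in U | v != u) phi u (s u) * phi v (s v)) <=
    eta * \sum_(s | agree L s0 s) q s * \sum_(u in U) phi u (s u) ^+ 2.

Definition marginally_bounded (q : {ffun V -> S} -> R) (b : R) : Prop :=
  forall L u s, u \notin L -> b * marg q L s <= marg q (u |: L) s.

Definition update s (u : V) (a : S) : {ffun V -> S} :=
  [ffun v => if v == u then a else s v].

Lemma agree_update L u s0 s :
  agree L s0 s -> agree (u |: L) (update s0 u (s u)) s.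
Proof.
move=> /agreeP E; apply/agreeP => v; rewrite !inE ffunE.
by case: eqVneq => [->//|_ /= /E].
Qed.

Lemma pinned_average (q : {ffun V -> S} -> R) L (f : {ffun V -> S} -> R) :
  (forall t, 0 < q t) ->
  \sum_s q s * f s =
  \sum_s0 q s0 / marg q L s0 * \sum_(s | agree L s0 s) q s * f s.
Proof.
move=> q_gt0; under [RHS]eq_bigr do rewrite mulr_sumr.
rewrite [RHS](exchange_big_dep xpredT)//=; apply: eq_bigr => s _.
rewrite (eq_bigl (agree L s)); last by move=> t; rewrite agree_sym.
rewrite (eq_bigr (fun t => q t * (q s * f s / marg q L s))); last first.
  by move=> t st; rewrite (marg_depends _ st); ring.
rewrite -mulr_suml -/(marg q L s).
have : marg q L s != 0 by rewrite gt_eqF ?marg_gt0.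
by move=> ?; field.
Qed.

Variables (p q : {ffun V -> S} -> R) (eta b : R) (K : nat).
Hypotheses (p_gt0 : forall t, 0 < p t) (q_gt0 : forall t, 0 < q t).
Hypothesis sum_p : \sum_t p t = 1.
Hypotheses (eta_ge0 : 0 <= eta) (b_gt0 : 0 < b) (b_le1 : b <= 1).
Hypotheses (q_cov : covariance_bounded q eta) (q_marg : marginally_bounded q b).
Hypothesis K_ge : 4 * eta / b <= K%:R.

Let rho := density p q.
Let x L u s : R := rho (u |: L) s / rho L s.

Let rho_gt0 L s : 0 < rho L s. Proof. exact: density_gt0. Qed.
Let x_gt0 L u s : 0 < x L u s. Proof. exact: divr_gt0. Qed.

Let rho_x L u s : rho L s * x L u s = rho (u |: L) s.
Proof. by rewrite /x mulrC divfK// gt_eqF. Qed.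

Let mean_density L (h : {ffun V -> S} -> R) : depends_on L h ->
  \sum_s q s * (rho L s * h s) = \sum_s p s * h s.
Proof. by move=> hL; rewrite change_of_measure. Qed.

Let mean_density1 L : \sum_s q s * rho L s = 1.
Proof.
rewrite -sum_p -[RHS](eq_bigr _ (fun s _ => mulr1 (p s))).
rewrite -(@mean_density L (fun=> 1))//.
by apply: eq_bigr => s _; rewrite mulr1.
Qed.

(** Let [x u] be the density, given the spins in [L], of the spin at [u]. By
    [relent_defect_ge] the second difference at [u], [v] is at least minus the
    mean conditional covariance of [x u] and [x v]. The covariance bound replaces the sum
    over pairs by [eta] times the sum of the conditional variances of the [x u], and
    since [x u <= b^-1] each variance is at most [4 / b] times the conditional
    entropy of the spin at [u], which is the first difference. *)
Lemma weakly_supermodular_relent : weakly_supermodular K (relent p q).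
Proof.
move=> L U disLU.
pose c L' u v s := (x L' u s - 1) * (x L' v s - 1).
have defect u v : - \sum_s q s * (rho L s * c L u v s) <=
    relent p q (v |: (u |: L)) - relent p q (u |: L) - relent p q (v |: L) + relent p q L.
  have -> : v |: (u |: L) = (u |: L) :|: (v |: L).
    by apply/setP=> y; rewrite !inE; case: (y == u); case: (y == v); case: (y \in L).
  have := @relent_defect_ge R V S p q p_gt0 q_gt0 sum_p (u |: L) (v |: L) L.
  rewrite !subsetUr => /(_ isT isT); apply: le_trans.
  rewrite le_eqVlt; apply/orP; left; apply/eqP.
  transitivity (\sum_s q s * rho (u |: L) s + \sum_s q s * rho (v |: L) s - \sum_s q s * rho L s
    - \sum_s q s * (rho (u |: L) s * rho (v |: L) s / rho L s)).
    rewrite -big_split/= -!sumrB -sumrN; apply: eq_bigr => s _.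
    by rewrite /c -!rho_x; field; rewrite gt_eqF.
  by rewrite !mean_density1; ring.
set D := \sum_(u in U) (_ - _).
have entropyE u : u \in U -> relent p q (u |: L) - relent p q L =
    \sum_s q s * (rho L s * (x L u s * ln (x L u s) - x L u s + 1)).
  move=> Uu; rewrite relentB ?subsetUr//.
  transitivity (\sum_s q s * (rho (u |: L) s * ln (x L u s)) - \sum_s q s * rho (u |: L) s
    + \sum_s q s * rho L s); first by rewrite !mean_density1; ring.
  by rewrite -sumrB -big_split/=; apply: eq_bigr => s _; rewrite -!rho_x; ring.
have x_le u s : u \in U -> x L u s <= b^-1.
  move=> Uu; have nLu : u \notin L by rewrite (disjointFl disLU).
  have nz r T : (forall t, 0 < r t) -> marg r T s != 0 by move=> ?;
    rewrite gt_eqF ?marg_gt0.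
  have -> : x L u s = (marg p (u |: L) s / marg p L s) * (marg q L s / marg q (u |: L) s).
    by rewrite /x /rho /density; field; rewrite !nz.
  rewrite -[leRHS]mul1r; apply: ler_pM.
  - by rewrite divr_ge0// ltW// marg_gt0.
  - by rewrite divr_ge0// ltW// marg_gt0.
  - rewrite ler_pdivrMr ?marg_gt0// mul1r /marg.
    rewrite [leRHS](bigID (fun t => agree (u |: L) s t))/= (eq_bigl (fun t => agree L
      s t && agree (u |: L) s t)).
      by rewrite lerDl; apply: sumr_ge0 => t _; apply: ltW.
    move=> t; case: (boolP (agree (u |: L) s t)); rewrite ?andbF// => E.
    by rewrite (agree_sub _ E)// subsetUr.
  - rewrite ler_pdivrMr ?marg_gt0// mulrC ler_pdivlMr// mulrC.
    exact: q_marg.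
have quad : \sum_s q s * (rho L s * \sum_(u in U) \sum_(v in U | v != u) c L u v s) <=
    eta * \sum_s q s * (rho L s * \sum_(u in U) (x L u s - 1) ^+ 2).
  (* Condition on the spins s0 in L; there x L u depends on the spin at u only. *)
  rewrite (pinned_average L _ q_gt0) [in leRHS](pinned_average L _ q_gt0) mulr_sumr.
  apply: ler_sum => s0 _; rewrite mulrCA ler_wpM2l//;
    first by rewrite divr_ge0// ltW// marg_gt0.
  pose phi u a := x L u (update s0 u a) - 1.
  have phiE u s : agree L s0 s -> phi u (s u) = x L u s - 1.
    move=> s0s; have E := agree_update u s0s; rewrite /phi /x /rho.
    by rewrite (density_depends _ _ E) (density_depends _ _ (agree_sub (subsetUr _ _) E)).
  have mean0 u : u \in U -> \sum_(s | agree L s0 s) q s * phi u (s u) = 0.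
    move=> _.
    have d0 : rho L s0 != 0 by rewrite gt_eqF.
    apply: (mulfI d0); rewrite mulr0 mulr_sumr.
    have hL : depends_on L (fun s => (agree L s0 s)%:R : R).
      by move=> s t st; rewrite ![agree L s0 _]agree_sym (agree_eql st).
    have hLu : depends_on (u |: L) (fun s => (agree L s0 s)%:R : R).
      by apply: depends_on_sub hL; rewrite subsetUr.
    have := mean_density hL; rewrite -(mean_density hLu) => /eqP.
    rewrite eq_sym -subr_eq0 -sumrB => /eqP e0; rewrite -[RHS]e0.
    rewrite [LHS]big_mkcond/=; apply: eq_bigr => s _.
    case: (boolP (agree L s0 s)) => s0s; last by rewrite !mulr0 subr0.
    by rewrite phiE// -rho_x /rho -(density_depends _ _ s0s) /= ?mulr1n; ring.
  have le1 := ler_wpM2l (ltW (rho_gt0 L s0)) (q_cov disLU mean0).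
  apply: (le_trans _ (le_trans le1 _)); rewrite le_eqVlt; apply/orP; left; apply/eqP.
    rewrite mulr_sumr; apply: eq_bigr => s s0s; rewrite [RHS]mulrCA.
    rewrite /rho (density_depends _ _ s0s); congr (_ * (_ * _)).
    by apply: eq_bigr => u _; apply: eq_bigr => v _; rewrite !phiE.
  rewrite mulrCA mulr_sumr; congr (_ * _); apply: eq_bigr => s s0s; rewrite mulrCA.
  rewrite /rho (density_depends _ _ s0s); congr (_ * (_ * _)).
  by apply: eq_bigr => u _; rewrite !phiE.
have sqr_le : \sum_s q s * (rho L s * \sum_(u in U) (x L u s - 1) ^+ 2) <= 4 / b * D.
  have -> : D = \sum_s q s * (rho L s * \sum_(u in U) (x L u s * ln (x L u s) - x L u s + 1)).
    rewrite /D (eq_bigr _ entropyE) exchange_big; apply: eq_bigr => s _.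
    by rewrite !mulr_sumr.
  rewrite mulr_sumr; apply: ler_sum => s _;
    rewrite [leRHS]mulrCA ler_wpM2l ?(ltW (q_gt0 s))//.
  rewrite [leRHS]mulrCA ler_wpM2l ?(ltW (rho_gt0 L s))// mulr_sumr.
  apply: ler_sum => u Uu; apply: xlnx_ge_sqr => //; first exact: x_le.
  by rewrite invf_ge1.
have D_ge0 : 0 <= D.
  by apply: sumr_ge0 => u _; rewrite subr_ge0 relent_mono// subsetUr.
apply: (@le_trans _ _ (- \sum_s q s * (rho L s * \sum_(u in U) \sum_(v in U | v != u) c L u v s))).
  rewrite lerN2; apply: le_trans quad _; apply: le_trans (ler_wpM2l eta_ge0 sqr_le) _.
  by rewrite mulrA ler_wpM2r// mulrCA mulrA.
rewrite -sumrN (eq_bigr (fun s => \sum_(u in U) \sum_(v in U | v != u) - (q s * (rho L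
  s * c L u v s)))); last first.
  move=> s _; rewrite !mulr_sumr -sumrN; apply: eq_bigr => u _.
  by rewrite !mulr_sumr -sumrN.
rewrite exchange_big; apply: ler_sum => u _; rewrite exchange_big;
  apply: ler_sum => v _.
by rewrite sumrN; exact: defect.
Qed.

End LocalEntropy.

(** * Spectral independence bounds covariances *)

Section SymmetricForms.

Import spectral complex.
Local Open Scope sesquilinear_scope.
Local Open Scope complex_scope.

(** Over the complex numbers [B] is unitarily diagonalizable with a real diagonal,
    whose entries are roots of the characteristic polynomial of [B] and so
    eigenvalues of [B] over [R]. *)
Lemma symmetric_form_le (R : rcfType) n (B : 'M[R]_n) (eta : R) (x : 'rV[R]_n) :
  B^T = B -> (forall lambda, eigenvalue B lambda -> lambda <= eta) ->
  (x *m B *m x^T) 0 0 <= eta * (x *m x^T) 0 0.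
Proof.
move=> symB eigB; pose f := real_complex R; pose A := map_mx f B.
have hermA : A \is hermsymmx.
  apply: realsym_hermsym.
    apply/is_hermitianmxP; rewrite expr0 scale1r map_mx_id//.
    by rewrite map_trmx symB.
  by apply/mxOverP => i j; rewrite !mxE; apply/complex_realP; exists (B i j).
have specA := orthomx_spectralP (hermitian_normalmx hermA).
have unitP := spectral_unitarymx A; have unitP' := spectral_unit A.
have := hermitian_spectral_diag_real hermA.
move: (spectralmx A) (spectral_diag A) specA unitP unitP' => P d specA unitP unitP' real_d.
have d_le i : d 0 i <= f eta.
  have /complex_realP[l dl] := mxOverP real_d 0 i.
  rewrite dl lecR; apply: eigB; rewrite eigenvalue_root_char.
  rewrite -(fmorph_root f) map_char_poly -/A -eigenvalue_root_char -[X in eigenvalue _ X]dl.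
  apply/eigenvalueP; exists (row i P).
    rewrite {1}specA !mulmxA -row_mul mulmxV// row1 -rowE row_diag_mx -scalemxAl.
    by rewrite -rowE.
  apply/negP => /eqP r0; have := mulmxV unitP'.
  move=> /(congr1 (row i)); rewrite row_mul r0 mul0mx row1 => /rowP/(_ i).
  by rewrite !mxE !eqxx => /eqP; rewrite eq_sym oner_eq0.
rewrite -(lecR) rmorphM/=.
pose y := map_mx f x *m P^t*.
have xt : (map_mx f x)^t* = (map_mx f x)^T.
  by apply/matrixP => i j; rewrite !mxE; apply/CrealP/complex_realP; exists (x j i).
have E1 : f ((x *m B *m x^T) 0 0) = \sum_i d 0 i * `|y 0 i| ^+ 2.
  transitivity ((map_mx f x *m A *m (map_mx f x)^T) 0 0).
    by rewrite map_trmx -!map_mxM [RHS]mxE.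
  rewrite specA invmx_unitary// -xt.
  have -> : map_mx f x *m (P^t* *m diag_mx d *m P) *m (map_mx f x)^t* = y *m diag_mx d *m y^t*.
    by rewrite /y trmx_mul map_mxM trmxCK !mulmxA.
  rewrite mxE; apply: eq_bigr => i _.
  by rewrite mul_mx_diag !mxE normCK; ring.
have E2 : f ((x *m x^T) 0 0) = \sum_i `|y 0 i| ^+ 2.
  transitivity ((map_mx f x *m (map_mx f x)^T) 0 0).
    by rewrite map_trmx -!map_mxM [RHS]mxE.
  have -> : map_mx f x *m (map_mx f x)^T = y *m y^t*.
    by rewrite /y trmx_mul map_mxM trmxCK mulmxA mulmxKtV// xt.
  rewrite mxE; apply: eq_bigr => i _.
  by rewrite !mxE normCK.
rewrite -/f E1 E2 mulr_sumr; apply: ler_sum => i _.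
by rewrite ler_wpM2r// exprn_ge0.
Qed.

End SymmetricForms.

(** [Psi] is self-adjoint for the inner product with weights [w]; conjugation by the
    diagonal matrix of square roots of the weights makes it symmetric with the same
    eigenvalues. *)
Lemma weighted_symmetric_form_le (R : rcfType) n (Psi : 'M[R]_n) (w x : 'I_n -> R)
    (eta : R) :
  (forall i, 0 < w i) -> (forall i j, w i * Psi i j = w j * Psi j i) ->
  (forall lambda, eigenvalue Psi lambda -> lambda <= eta) ->
  \sum_i \sum_j x i * x j * (w i * Psi i j) <= eta * \sum_i w i * x i ^+ 2.
Proof.
move=> w_gt0 symPsi eigPsi.
pose r i := Num.sqrt (w i).
have r_gt0 i : 0 < r i by rewrite sqrtr_gt0.
have r0 i : r i != 0 by rewrite gt_eqF.
have rr i : w i = r i ^+ 2 by rewrite sqr_sqrtr// ltW.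
pose B := \matrix_(i, j) (r i * Psi i j / r j) : 'M[R]_n.
have symB : B^T = B.
  apply/matrixP => i j; rewrite !mxE.
  have := symPsi i j; rewrite !rr => E.
  transitivity ((r j ^+ 2 * Psi j i) / (r i * r j)); first by field; rewrite !r0.
  by rewrite -E; field; rewrite !r0.
have eigB lambda : eigenvalue B lambda -> lambda <= eta.
  move=> /eigenvalueP[v vB v0]; apply: eigPsi; apply/eigenvalueP.
  exists (\row_i (v 0 i * r i)).
    apply/rowP => j; rewrite !mxE.
    have := congr1 (fun z : 'rV__ => z 0 j * r j) vB;
      rewrite !mxE mulr_suml mulrA => <-.
    by apply: eq_bigr => i _; rewrite !mxE; field; rewrite r0.
  apply: contra v0 => /eqP z; apply/eqP/rowP => i.
  have := congr1 (fun z : 'rV__ => z 0 i) z; rewrite !mxE => /eqP.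
  by rewrite mulf_eq0 (negbTE (r0 i)) orbF => /eqP.
have := symmetric_form_le (\row_i (r i * x i)) symB eigB.
rewrite !mxE; congr (_ <= _).
  rewrite exchange_big; apply: eq_bigr => j _; rewrite !mxE mulr_suml.
  by apply: eq_bigr => i _; rewrite !mxE rr; field; rewrite r0.
by congr (_ * _); apply: eq_bigr => i _; rewrite !mxE rr; ring.
Qed.

Section InfluenceForm.

Variables (R : realType) (V S : finType) (mu : {ffun V -> S} -> R) (eta : R).
Hypothesis mu_gt0 : forall s, 0 < mu s.

(** With weights [w (u, a)], the conditional probability of spin [a] at [u], the
    influence matrix is the matrix of the covariances of the indicators of pairs at
    distinct vertices. Evaluate its quadratic form at the values of the functions
    [phi u]. *)
Lemma spectral_covariance_bounded :
  spectrally_independent mu eta -> covariance_bounded mu eta.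
Proof.
move=> SI L U s0 phi disLU mean0.
have [->|[u0 Uu0]] := set_0Vmem U.
  rewrite big1 => [|s _]; last by rewrite big_set0 mulr0.
  by rewrite big1 ?mulr0// => s _; rewrite big_set0 mulr0.
pose tau := [ffun v : {v : V | v \in L} => s0 (val v)].
have in_pin s : (s \in pin_event tau) = agree L s0 s.
  rewrite inE; apply/forallP/agreeP => [E v Lv|E v].
    by have /eqP := E (Sub v Lv); rewrite ffunE.
  by rewrite ffunE -E ?eqxx// (valP v).
set m := prob mu (pin_event tau).
have mE : m = marg mu L s0 by apply: eq_bigl => s; rewrite in_pin.
have m_gt0 : 0 < m by rewrite mE marg_gt0.
have L_neq : ~: L != set0.
  by apply/set0Pn; exists u0; rewrite inE (disjointFl disLU Uu0).
have := SI L tau L_neq m_gt0.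
pose w (x : V * S) := cond_prob mu (spin_event x.1 x.2) (pin_event tau).
pose j (x y : V * S) := cond_prob mu (spin_event x.1 x.2 :&: spin_event y.1 y.2) (pin_event tau).
pose ind (x : V * S) (s : {ffun V -> S}) : R := (s x.1 == x.2)%:R.
have wE x : w x = \sum_(s | agree L s0 s) mu s * ind x s / m.
  rewrite /w /cond_prob /prob -/m mulr_suml.
  rewrite [LHS]big_mkcond [RHS]big_mkcond; apply: eq_bigr => s _.
  rewrite /ind in_setI in_pin !inE.
  by case: (s x.1 == x.2); case: (agree _ _ _); rewrite ?mulr1 ?mulr0 ?mul0r.
have jE x y : j x y = \sum_(s | agree L s0 s) mu s * (ind x s * ind y s) / m.
  rewrite /j /cond_prob /prob -/m mulr_suml.
  rewrite [LHS]big_mkcond [RHS]big_mkcond; apply: eq_bigr => s _.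
  rewrite /ind in_setI in_pin !inE.
  by case: (s x.1 == x.2); case: (s y.1 == y.2); case: (agree _ _ _);
    rewrite ?mulr1 ?mulr0 ?mul0r.
have jC x y : j x y = j y x by rewrite /j setIC.
have w_gt0 x : x.1 \notin L -> 0 < w x.
  move=> Lx; rewrite /w /cond_prob -/m divr_gt0// /prob (bigD1 (update s0 x.1 x.2))/=.
    by rewrite ltr_wpDr// sumr_ge0// => s _; rewrite ltW.
  rewrite in_setI in_pin inE ffunE !eqxx/=.
  apply/agreeP => v Lv; rewrite ffunE; case: eqVneq => // vx.
  by move: Lx; rewrite -vx Lv.
have feasE x : (x \in feasible_pairs mu tau) = (x.1 \notin L).
  by rewrite inE; case: (boolP (x.1 \in L)) => //= /w_gt0.
have inflE x y : x.1 \notin L -> x.1 != y.1 -> w x * influence mu tau x y = j x y - w x * w y.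
  move=> Lx /negbTE nxy; rewrite /influence nxy mulrBr; congr (_ - _).
  have := w_gt0 x Lx; rewrite /w /j /cond_prob -/m setIA [_ :&: spin_event x.1 _]setIC.
  set c := prob mu (spin_event x.1 _ :&: pin_event _) => cm_gt0.
  have c0 : c != 0 by apply: contraTneq cm_gt0 => ->; rewrite mul0r ltxx.
  by field; rewrite c0 gt_eqF.
have infl0 x y : x.1 == y.1 -> influence mu tau x y = 0 by rewrite /influence => ->.
move=> eig.
pose X (x : V * S) := if x.1 \in U then phi x.1 x.2 else 0.
have := @weighted_symmetric_form_le R _ (influence_mx mu tau)
  (fun i => w (enum_val i)) (fun i => X (enum_val i)) eta _ _ eig.
have enumL (i : 'I_#|feasible_pairs mu tau|) : (enum_val i : V * S).1 \notin L by
  rewrite -feasE; exact: enum_valP.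
have symw i k : w (enum_val i) * influence_mx mu tau i k =
    w (enum_val k) * influence_mx mu tau k i.
  rewrite !mxE; case: (boolP ((enum_val i).1 == (enum_val k).1)) => [e|ne].
    by rewrite !infl0 ?mulr0// eq_sym.
  by rewrite !inflE// 1?eq_sym// jC [w _ * w _]mulrC.
move=> /(_ (fun i => w_gt0 _ (enumL i)) symw).
have sumF G : (forall x, x.1 \notin U -> G x = 0) ->
    \sum_(x in feasible_pairs mu tau) G x = \sum_(u in U) \sum_a G (u, a) :> R.
  move=> G0; rewrite pair_big_dep/= [LHS]big_mkcond [RHS]big_mkcond.
  apply: eq_bigr => -[u a] _ /=; rewrite feasE/= andbT.
  case: (boolP (u \in U)) => [Uu|nUu]; first by rewrite (disjointFl disLU Uu).
  by rewrite G0// if_same.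
have sum_ind u s (h : S -> R) : \sum_a h a * ind (u, a) s = h (s u).
  rewrite (bigD1 (s u))//= big1 ?addr0 /ind ?eqxx ?mulr1// => a ne.
  by rewrite /= eq_sym (negbTE ne) mulr0.
have mean_w u : u \in U -> \sum_a phi u a * w (u, a) = 0.
  move=> Uu; rewrite -[RHS](mul0r m^-1) -[X in _ = X / _](mean0 u Uu) mulr_suml.
  under eq_bigr do rewrite wE mulr_sumr.
  rewrite exchange_big; apply: eq_bigr => s _.
  by rewrite -(sum_ind u s (phi u)) mulr_sumr mulr_suml; apply: eq_bigr => a _; ring.
have sum_j u v : \sum_a \sum_b phi u a * phi v b * j (u, a) (v, b) =
    \sum_(s | agree L s0 s) mu s * (phi u (s u) * phi v (s v)) / m.
  under eq_bigr do under eq_bigr do rewrite jE mulr_sumr.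
  under eq_bigr do rewrite exchange_big.
  rewrite exchange_big; apply: eq_bigr => s _.
  rewrite -(sum_ind u s (phi u)) mulr_suml mulr_sumr mulr_suml; apply: eq_bigr => a _.
  rewrite -(sum_ind v s (phi v)) !mulr_sumr mulr_suml; apply: eq_bigr => b _; ring.
have -> : \sum_i \sum_k X (enum_val i) * X (enum_val k) *
     (w (enum_val i) * influence_mx mu tau i k) =
   m^-1 * \sum_(s | agree L s0 s) mu s *
      (\sum_(u in U) \sum_(v in U | v != u) phi u (s u) * phi v (s v)).
  transitivity (\sum_(x in feasible_pairs mu tau) \sum_(y in feasible_pairs mu tau)
     X x * X y * (w x * influence mu tau x y)).
    rewrite [RHS]big_enum_val; apply: eq_bigr => i _; rewrite [RHS]big_enum_val.
    by apply: eq_bigr => k _; rewrite mxE.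
  rewrite sumF; last first.
    by move=> x /negbTE Ux; rewrite big1// => y _; rewrite /X Ux !mul0r.
  transitivity (\sum_(u in U) \sum_(v in U | v != u)
      \sum_(s | agree L s0 s) mu s * (phi u (s u) * phi v (s v)) / m); last first.
    rewrite mulr_sumr.
    under [RHS]eq_bigr do rewrite !mulr_sumr.
    rewrite [RHS]exchange_big; apply: eq_bigr => u _.
    under [RHS]eq_bigr do rewrite !mulr_sumr.
    by rewrite [RHS]exchange_big; apply: eq_bigr => v _; apply: eq_bigr => s _; ring.
  apply: eq_bigr => u Uu.
  have nLu : u \notin L by rewrite (disjointFl disLU Uu).
  rewrite (eq_bigr (fun a => \sum_(v in U) \sum_b X (u, a) * X (v, b) *
     (w (u, a) * influence mu tau (u, a) (v, b)))); last first.
    move=> a _; rewrite sumF// => y /negbTE Uy.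
    by rewrite [X y]/X Uy mulr0 mul0r.
  rewrite exchange_big big_mkcondr/=; apply: eq_bigr => v Uv.
  have [->|nvu] := eqVneq v u.
    by rewrite big1// => a _; rewrite big1// => b _; rewrite infl0 ?eqxx ?mulr0.
  rewrite -sum_j.
  transitivity (\sum_a \sum_b phi u a * phi v b * j (u, a) (v, b)
     - (\sum_a phi u a * w (u, a)) * (\sum_b phi v b * w (v, b))).
    rewrite mulr_suml -sumrB; apply: eq_bigr => a _; rewrite mulr_sumr -sumrB.
    by apply: eq_bigr => b _; rewrite /X /= Uu Uv inflE// 1?eq_sym//; ring.
  by rewrite mean_w// mul0r subr0.
have -> : \sum_(i < #|feasible_pairs mu tau|) w (enum_val i) * X (enum_val i) ^+ 2 =
   m^-1 * \sum_(s | agree L s0 s) mu s * \sum_(u in U) phi u (s u) ^+ 2.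
  transitivity (\sum_(x in feasible_pairs mu tau) w x * X x ^+ 2).
    by rewrite [RHS]big_enum_val; apply: eq_bigr => i _.
  rewrite sumF; last by move=> x /negbTE Ux; rewrite /X Ux expr0n mulr0.
  rewrite mulr_sumr; under [RHS]eq_bigr do rewrite !mulr_sumr.
  rewrite [RHS]exchange_big; apply: eq_bigr => u Uu.
  under [LHS]eq_bigr do rewrite wE mulr_suml.
  rewrite exchange_big; apply: eq_bigr => s _.
  rewrite -(sum_ind u s (fun a => phi u a ^+ 2)) !mulr_sumr; apply: eq_bigr => a _.
  by rewrite /X /= Uu; ring.
by rewrite mulrCA ler_pM2l// invr_gt0.
Qed.

End InfluenceForm.

(** * Clusters and shattering *)

Lemma card_bigcup_le (I T : finType) (P : pred I) (F : I -> {set T}) :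
  (#|\bigcup_(i | P i) F i| <= \sum_(i | P i) #|F i|)%N.
Proof.
elim/big_rec2: _ => [|i n A _ le_An]; first by rewrite cards0.
by apply: leq_trans (leq_card_setU _ _) _; rewrite leq_add2l.
Qed.

Section Clusters.

Variables (V : finType) (E : {set {set V}}).
Implicit Types (C S T X : {set V}).

Definition boundary C : {set V} :=
  [set v | (v \notin C) && [exists u in C, [set u; v] \in E]].

Lemma boundaryP C v :
  reflect (v \notin C /\ exists2 u, u \in C & [set u; v] \in E) (v \in boundary C).
Proof.
rewrite inE; apply: (iffP andP) => -[nCv].
  by move=> /exists_inP[u Cu uv]; split=> //; exists u.
by move=> [u Cu uv]; split=> //; apply/exists_inP; exists u.
Qed.

Lemma card_boundary_le C : (#|boundary C| <= #|C| * max_degree E)%N.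
Proof.
have degE u : (#|[set v | [set u; v] \in E]| <= max_degree E)%N.
  apply: leq_trans (leq_bigmax u).
  have inj : injective (fun v => [set u; v]).
    move=> v w /setP eq; have := eq v; have := eq w.
    rewrite !inE !eqxx !orbT => /orP[]/eqP wE /esym/orP[]/eqP vE //; congruence.
  rewrite -(card_imset _ inj) subset_leq_card//; apply/subsetP => e /imsetP[v].
  by rewrite !inE => uv ->; rewrite uv !inE eqxx.
have sub : boundary C \subset \bigcup_(u in C) [set v | [set u; v] \in E].
  apply/subsetP => v /boundaryP[_ [u Cu uv]].
  by apply/bigcupP; exists u; rewrite ?inE.
apply: leq_trans (subset_leq_card sub) _.
apply: leq_trans (card_bigcup_le _ _) _.
by rewrite -sum_nat_const leq_sum.
Qed.

(** The connected sets of [k.+1] vertices, grown by one boundary vertex at a time.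
    The construction is what bounds their number in [card_clusters_le]: at most
    [k * max_degree E] vertices can be added at each step. *)
Fixpoint clusters (k : nat) : {set {set V}} :=
  if k is j.+1 then \bigcup_(C in clusters j) [set v |: C | v in boundary C]
  else [set [set v] | v : V].

Lemma clustersSP k C : reflect
  (exists2 C', C' \in clusters k & exists2 v, v \in boundary C' & C = v |: C')
  (C \in clusters k.+1).
Proof.
apply: (iffP bigcupP) => [[C' C'k /imsetP[v bv ->]]|[C' C'k [v bv ->]]].
  by exists C' => //; exists v.
by exists C' => //; apply/imsetP; exists v.
Qed.

Lemma card_cluster k C : C \in clusters k -> #|C| = k.+1.
Proof.
elim: k C => [|k IHk] C; first by move=> /imsetP[v _ ->]; rewrite cards1.
move=> /clustersSP[C' /IHk cC' [v /boundaryP[nC'v _] ->]].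
by rewrite cardsU1 nC'v cC'.
Qed.

Lemma card_clusters_le k :
  (#|clusters k| <= #|V| * (k * max_degree E) ^ k)%N.
Proof.
suff H j : (j <= k)%N -> (#|clusters j| <= #|V| * (k * max_degree E) ^ j)%N.
  exact: H.
elim: j => [|j IHj] ltjk /=.
  by rewrite muln1; apply: leq_trans (leq_imset_card _ _) _; rewrite max_card.
apply: leq_trans (card_bigcup_le _ _) _.
apply: (@leq_trans (\sum_(C in clusters j) k * max_degree E)).
  apply: leq_sum => C /card_cluster cC.
  apply: leq_trans (leq_imset_card _ _) _; apply: leq_trans (card_boundary_le C) _.
  by rewrite cC leq_mul2r ltjk orbT.
by rewrite sum_nat_const expnSr [leqRHS]mulnA leq_mul2r IHj ?orbT// ltnW.
Qed.

Definition shattered k S : bool := [forall C in clusters k, ~~ (C \subset S)].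

Lemma shattered_sub k S T : T \subset S -> shattered k S -> shattered k T.
Proof.
move=> sTS /forall_inP H; apply/forall_inP => C /H.
by apply: contra => /subset_trans; apply.
Qed.

(** Take a cluster inside [S] of the largest possible size. *)
Lemma shattered_component k S : shattered k S -> S != set0 ->
  exists C : {set V}, [/\ C \subset S, C != set0, (#|C| <= k)%N &
    forall u v, u \in C -> v \in S :\: C -> [set u; v] \notin E].
Proof.
move=> shS /set0Pn[v0 Sv0].
pose P j := [exists C in clusters j, C \subset S].
have exP : exists j, P j.
  exists 0%N; apply/exists_inP; exists [set v0]; last by rewrite sub1set.
  by apply/imsetP; exists v0.
have leP j : P j -> (j <= #|V|)%N.
  move=> /exists_inP[C /card_cluster cC _].
  by apply: leq_trans (max_card [in C]); rewrite cC.
case: (ex_maxnP exP leP) => j /exists_inP[C Cj sCS] maxj.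
have down i : P i.+1 -> P i.
  move=> /exists_inP[C' /clustersSP[C'' C''i [v _ ->]]].
  by rewrite subUset => /andP[_ s]; apply/exists_inP; exists C''.
have ltjk : (j < k)%N.
  rewrite ltnNge; apply/negP => lekj.
  have : P k.
    have : P j by apply/exists_inP; exists C.
    by rewrite -(subnK lekj); elim: (j - k)%N => // d IHd; rewrite addSn => /down.
  by move=> /exists_inP[C' C'k sC']; move: (forall_inP shS _ C'k); rewrite sC'.
exists C; split=> //; first by rewrite -card_gt0 (card_cluster Cj).
  by rewrite (card_cluster Cj).
move=> u v Cu; rewrite inE => /andP[nCv Sv]; apply/negP => uv.
have : P j.+1.
  apply/exists_inP; exists (v |: C); last by rewrite subUset sub1set Sv.
  by apply/clustersSP; exists C => //; exists v => //; apply/boundaryP; split=> //;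
    exists u.
by move=> /maxj; rewrite ltnn.
Qed.

(** A union bound over clusters. *)
Lemma bernoulli_not_shattered_le (R : realFieldType) (theta : R) k :
  0 <= theta <= 1 ->
  \sum_(S | ~~ shattered k S) bernoulli setT theta S <=
  (#|V| * (k * max_degree E) ^ k)%:R * theta ^+ k.+1.
Proof.
move=> th01; have /andP[th_ge0 _] := th01.
apply: (@le_trans _ _ (\sum_(C in clusters k) theta ^+ k.+1)); last first.
  rewrite sumr_const -[_ *+ #|_|]mulr_natl ler_wpM2r ?exprn_ge0//.
  by rewrite ler_nat card_clusters_le.
apply: (@le_trans _ _ (\sum_(C in clusters k) \sum_(S : {set V} | C \subset S)
  bernoulli setT theta S)).
  rewrite (exchange_big_dep xpredT)//= [leLHS]big_mkcond/=; apply: ler_sum => S _.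
  have w_ge0 : 0 <= bernoulli setT theta S by rewrite bernoulli_ge0.
  case: ifP => [|_]; last by apply: sumr_ge0 => C _.
  rewrite negb_forall_in => /exists_inP[C Ck]; rewrite negbK => sCS.
  by rewrite (bigD1 C) ?Ck//= lerDl; apply: sumr_ge0.
apply: ler_sum => C /card_cluster cC.
rewrite (eq_bigl (fun S : {set V} => (S \subset setT) && (C \subset S))); last first.
  by move=> S; rewrite subsetT.
by rewrite bernoulli_contains ?subsetT// cC.
Qed.

End Clusters.

Section Shattering.

Variables (R : realFieldType) (V J : finType) (E : {set {set V}}).
Variables (K k : nat) (g : {set V} -> R) (wt : J -> R) (iso : J -> {set V}) (eps : R).
Implicit Types (A B C S T X : {set V}).

(** The supermodularity that the relative entropies inherit from the spatial Markov
    property: [B] and the part of [A] inside [C] are separated by the vertices common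
    to [A] and [B], since these contain the boundary of [C]. *)
Definition markov_supermodular : Prop := forall A B C,
  boundary E C \subset A :&: B -> [disjoint B & C] -> A :\: B \subset C ->
  g A + g B <= g (A :|: B) + g (A :&: B).

Hypothesis g_super : weakly_supermodular K g.
Hypothesis g_mono : {homo g : A B / A \subset B >-> A <= B}.
Hypothesis g_markov : markov_supermodular.
Hypothesis wt_ge0 : forall j, 0 <= wt j.
Hypothesis iso_prob : forall T, (#|T| <= K.+1)%N ->
  eps <= \sum_(j | T \subset iso j) wt j.
Hypothesis eps_ge0 : 0 <= eps.

(** Peel a component [C] off [S] and pick in it a small set [T] carrying a fraction
    [k ^- K.+1] of its gain. Whether or not [T] is removed, removing isolated vertices
    of the rest of [S] gains at least as much as it does once all of [C] has been
    removed. Only the probability that [T] is isolated enters, by linearity of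
    expectation: the events attached to different components may be dependent. The
    hypothesis on the edges at [S] keeps the boundary of the later components inside
    what remains of [X]. *)
Lemma isolated_removal_gain X S : shattered E k S -> S \subset X ->
  (forall u v, u \in S -> [set u; v] \in E -> v \in X) ->
  eps / k%:R ^+ K.+1 * (g X - g (X :\: S)) <=
  \sum_j wt j * (g X - g (X :\: (iso j :&: S))).
Proof.
have [m] := ubnP #|S|; elim: m => // m IHm in X S *; rewrite ltnS => leSm shS sSX nbX.
have [S0|nS0] := eqVneq S set0.
  rewrite S0 setD0 subrr mulr0 big1// => j _.
  by rewrite setI0 setD0 subrr mulr0.
have [C [sCS nC0 leCk nCE]] := shattered_component shS nS0.
have sCX := subset_trans sCS sSX.
have k_gt0 : (0 < k)%N by apply: leq_trans leCk; rewrite card_gt0.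
have kp_gt0 : 0 < k%:R ^+ K.+1 :> R by rewrite exprn_gt0// ltr0n.
have [T [sTC leTK gainT]] := exists_small_removal g_super g_mono k_gt0 sCX leCk.
pose X' := X :\: C; pose S' := S :\: C.
have step j : (T \subset iso j)%:R * (g X - g (X :\: T)) +
    (g X' - g (X' :\: (iso j :&: S'))) <= g X - g (X :\: (iso j :&: S)).
  pose T' := if T \subset iso j then T else set0.
  pose Rm := iso j :&: S'.
  have sT'C : T' \subset C by rewrite /T'; case: ifP; rewrite ?sub0set.
  have gainT' : (T \subset iso j)%:R * (g X - g (X :\: T)) = g X - g (X :\: T').
    by rewrite /T'; case: ifP => _; rewrite ?mul1r// mul0r setD0 subrr.
  have gainAll : g (X :\: (iso j :&: S)) <= g (X :\: T' :\: Rm).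
    apply: g_mono; apply/subsetP => v; rewrite !inE => /andP[nv Xv]; rewrite Xv andbT.
    apply/andP; split; first by apply: contra nv => /and3P[-> _ ->].
    apply: contra nv; rewrite /T'; case: ifP => [sTi Tv|_]; last by rewrite inE.
    by rewrite (subsetP sTi)// (subsetP sCS)// (subsetP sTC).
  have := @g_markov (X :\: T' :\: Rm) X' C.
  have -> : X :\: T' :\: Rm :|: X' = X :\: T'.
    apply/setP => v; rewrite !inE; have := subsetP sT'C v.
    by case: (v \in T'); case: (v \in C); case: (v \in X); case: (v \in S);
      case: (v \in iso j) => //= /(_ isT).
  have -> : (X :\: T' :\: Rm) :&: X' = X' :\: Rm.
    apply/setP => v; rewrite !inE; have := subsetP sT'C v.
    by case: (v \in T'); case: (v \in C); case: (v \in X); case: (v \in S);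
      case: (v \in iso j) => //= /(_ isT).
  have h1 : boundary E C \subset X' :\: Rm.
    apply/subsetP => v /boundaryP[nCv [u Cu uv]].
    have Xv : v \in X by apply: (nbX u); rewrite ?(subsetP sCS).
    rewrite !inE nCv Xv !andbT; apply/negP => /andP[_ Sv].
    by have := nCE u v Cu; rewrite !inE nCv Sv uv => /(_ isT).
  have h2 : [disjoint X' & C].
    by rewrite -setI_eq0 /X' setDE -setIA [_ :&: C]setIC setICr setI0.
  have h3 : X :\: T' :\: Rm :\: X' \subset C.
    apply/subsetP => v; rewrite !inE; case: (v \in C) => //=.
    by case: (v \in X); rewrite ?andbF.
  move=> /(_ h1 h2 h3); rewrite gainT'; move: gainAll; rewrite -/Rm; lra.
have IH : eps / k%:R ^+ K.+1 * (g X' - g (X' :\: S')) <=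
    \sum_j wt j * (g X' - g (X' :\: (iso j :&: S'))).
  apply: IHm.
  - apply: leq_trans leSm; rewrite proper_card// properEneq subsetDl andbT.
    apply: contraNneq nC0 => S'S; rewrite -subset0; apply/subsetP => v Cv.
    have := subsetP sCS v Cv; have /setP/(_ v) := S'S.
    by rewrite !inE Cv /= => <-.
  - exact: shattered_sub (subsetDl _ _) shS.
  - exact: setSD.
  - move=> u v; rewrite !inE => /andP[nCu Su] uv; rewrite (nbX u v)// andbT.
    apply/negP => Cv; have := nCE v u Cv; rewrite !inE nCu Su setUC uv.
    by move=> /(_ isT).
have XS : X' :\: S' = X :\: S.
  apply/setP => v; rewrite !inE; have := subsetP sCS v.
  by case: (v \in C); case: (v \in S) => //= /(_ isT).
apply: (@le_trans _ _ (\sum_j wt j * ((T \subset iso j)%:R * (g X - g (X :\: T)) +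
    (g X' - g (X' :\: (iso j :&: S')))))); last first.
  by apply: ler_sum => j _; rewrite ler_wpM2l.
under eq_bigr do rewrite mulrDr.
rewrite big_split/=.
have first : eps / k%:R ^+ K.+1 * (g X - g X') <=
    \sum_j wt j * ((T \subset iso j)%:R * (g X - g (X :\: T))).
  under eq_bigr do rewrite mulrA.
  rewrite -mulr_suml; apply: (@le_trans _ _ (eps * (g X - g (X :\: T)))).
    by rewrite -mulrA ler_wpM2l// mulrC ler_pdivrMr// mulrC.
  rewrite ler_wpM2r ?subr_ge0 ?g_mono ?subsetDl//.
  apply: le_trans (iso_prob leTK) _; rewrite big_mkcond/=.
  by apply: ler_sum => j _; case: ifP; rewrite ?mulr1 ?mulr0.
apply: le_trans (lerD first IH); rewrite XS -mulrDr.
by rewrite le_eqVlt; apply/orP; left; apply/eqP; congr (_ * _); ring.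
Qed.

(** Average [isolated_removal_gain] over a product set [S] of density [theta]. By
    hypothesis the sets that are not shattered have so small a probability that they
    carry at most half of the gain given by [bernoulli_removal_gain]. *)
Lemma isolated_gain (theta : R) : 0 <= theta <= 1 ->
  (#|V| * (k * max_degree E) ^ k)%:R * theta ^+ k.+1 <= theta ^+ K.+1 / 2 ->
  (theta ^+ K.+1 / 2) * (eps / k%:R ^+ K.+1) * (g setT - g set0) <=
  \sum_j wt j * (g setT - g (~: iso j)).
Proof.
move=> th01 small.
set G := leRHS.
have gain_ge0 A : 0 <= g setT - g A by rewrite subr_ge0 g_mono ?subsetT.
have G_ge0 : 0 <= G by apply: sumr_ge0 => j _; rewrite mulr_ge0.
have w_ge0 S : 0 <= bernoulli setT theta S by rewrite bernoulli_ge0.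
have sumw : \sum_(S : {set V}) bernoulli setT theta S = 1.
  by rewrite -(bernoulli_sum [set: V] theta); apply: eq_bigl => S; rewrite subsetT.
have c_ge0 : 0 <= eps / k%:R ^+ K.+1 by rewrite divr_ge0// exprn_ge0.
have good S : shattered E k S -> eps / k%:R ^+ K.+1 * (g setT - g (~: S)) <= G.
  move=> shS; have := isolated_removal_gain shS (subsetT S).
  rewrite setTD => /(_ (fun _ _ _ _ => in_setT _)) /le_trans; apply.
  apply: ler_sum => j _; rewrite ler_wpM2l// lerD2l lerN2 g_mono//.
  by rewrite setTD setCS subsetIl.
have := bernoulli_removal_gain g_super g_mono th01.
rewrite (bigID (shattered E k))/=.
set g1 := (X in _ <= X + _ -> _); set g2 := (X in _ <= _ + X -> _) => total.
have bad : g2 <= theta ^+ K.+1 / 2 * (g setT - g set0).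
  apply: (@le_trans _ _ ((\sum_(S | ~~ shattered E k S) bernoulli setT theta S) * (g
    setT - g set0))).
    rewrite mulr_suml; apply: ler_sum => S _; rewrite ler_wpM2l//.
    by rewrite lerD2l lerN2 g_mono ?sub0set.
  rewrite ler_wpM2r//; apply: le_trans small; exact: bernoulli_not_shattered_le.
have g1_ge : theta ^+ K.+1 / 2 * (g setT - g set0) <= g1 by lra.
apply: (@le_trans _ _ (eps / k%:R ^+ K.+1 * g1)).
  by rewrite mulrAC mulrC ler_wpM2l.
rewrite mulr_sumr; apply: (@le_trans _ _ (\sum_(S | shattered E k S) bernoulli setT theta S * G)).
  by apply: ler_sum => S shS; rewrite mulrCA ler_wpM2l// good.
rewrite -mulr_suml ler_piMl// -sumw [leRHS](bigID (shattered E k))/= lerDl.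
exact: sumr_ge0.
Qed.

End Shattering.

(** * The Markov property of the Potts measure *)

Section PottsMeasure.

Variables (R : realType) (V : finType) (q : nat) (beta : R) (E : {set {set V}}).
Implicit Types (s t u : {ffun V -> 'I_q}) (A B C L : {set V}) (e : {set V}).

Definition potts_weight s : R := \prod_(e in E) expR (beta * (monochromatic s e)%:R).

Lemma expR_hamiltonian s : expR (- hamiltonian beta E s) = potts_weight s.
Proof. by rewrite /hamiltonian mulNr opprK mulr_sumr expR_sum. Qed.

Lemma potts_weight_gt0 s : 0 < potts_weight s.
Proof. by apply: prodr_gt0 => e _; rewrite expR_gt0. Qed.

Lemma pottsE s : potts beta E s = potts_weight s / partition_function q beta E.
Proof. by rewrite /potts expR_hamiltonian. Qed.

Lemma partition_functionE : partition_function q beta E = \sum_s potts_weight s.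
Proof. by apply: eq_bigr => s _; rewrite expR_hamiltonian. Qed.

Lemma monochromatic_agree s t e : agree e s t -> monochromatic s e = monochromatic t e.
Proof.
move=> /agreeP st; apply: eq_forallb => a; case: (boolP (a \in e)) => //= ea.
by apply: eq_forallb => b; case: (boolP (b \in e)) => //= eb; rewrite !st.
Qed.

Local Notation mu := (@potts R V q beta E).

Hypothesis q_gt0 : (0 < q)%N.

Lemma partition_function_gt0 : 0 < partition_function q beta E.
Proof.
rewrite partition_functionE (bigD1 [ffun=> Ordinal q_gt0])//=.
rewrite ltr_wpDr ?potts_weight_gt0//.
by apply: sumr_ge0 => s _; rewrite ltW ?potts_weight_gt0.
Qed.

Lemma potts_gt0 s : 0 < mu s.
Proof. by rewrite pottsE divr_gt0 ?potts_weight_gt0 ?partition_function_gt0. Qed.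

Lemma sum_potts : \sum_s mu s = 1.
Proof.
under eq_bigr do rewrite pottsE.
by rewrite -mulr_suml -partition_functionE divff// gt_eqF ?partition_function_gt0.
Qed.

Hypothesis graphE : simple_graph E.

Definition glue C s t : {ffun V -> 'I_q} := [ffun v => if v \in C then s v else t v].

(** Exchanging the spins of two configurations inside [C] permutes or preserves the
    two weights of each edge: an edge that meets [C] has its other end in [C] or on
    the boundary, where the configurations agree. *)
Lemma potts_glue C s t : agree (boundary E C) s t ->
  mu (glue C s t) * mu (glue C t s) = mu s * mu t.
Proof.
move=> /agreeP st; rewrite !pottsE.
suff E1 : potts_weight (glue C s t) * potts_weight (glue C t s) =
    potts_weight s * potts_weight t.
  by rewrite mulrACA E1 mulrACA.
rewrite /potts_weight -!big_split/=; apply: eq_bigr => e Ee.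
have [dis|] := boolP [disjoint e & C].
  have gl (x y : {ffun V -> 'I_q}) : agree e y (glue C x y).
    by apply/agreeP => v ev; rewrite ffunE (disjointFr dis ev).
  by rewrite -!(monochromatic_agree (gl _ _)) mulrC.
move=> /pred0Pn[a /andP[/= ea Ca]].
have gl (x y : {ffun V -> 'I_q}) : (forall v, v \in boundary E C -> x v = y v) ->
  agree e x (glue C x y).
  move=> xy; apply/agreeP => v ev; rewrite ffunE; case: ifP => // nCv.
  apply: xy; apply/boundaryP; split; first by rewrite nCv.
  exists a => //.
  have /eqP/cards2P[c [d [ncd eE]]] := graphE Ee.
  suff eav : e = [set a; v] by rewrite -eav.
  have nav : a != v by apply: contraFneq nCv => <-.
  move: ea ev nav; rewrite eE !inE => /orP[]/eqP-> /orP[]/eqP->; rewrite ?eqxx//.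
  by rewrite setUC.
rewrite -(monochromatic_agree (gl s t _))//.
by rewrite -(monochromatic_agree (gl t s _))// => v bv; rewrite st.
Qed.

(** Conditional independence of the spins in [A] and in [B] given those in
    [A :&: B]: the exchange of the spins inside [C] is a bijection between the pairs
    of configurations counted on the two sides. *)
Lemma potts_markov A B C s :
  boundary E C \subset A :&: B -> [disjoint B & C] -> A :\: B \subset C ->
  marg mu (A :|: B) s * marg mu (A :&: B) s =
  marg mu A s * marg mu B s.
Proof.
move=> sbd disBC sAB; 
pose h (x : {ffun V -> 'I_q} * {ffun V -> 'I_q}) := (glue C x.1 x.2, glue C x.2 x.1).
have hK : involutive h.
  by case=> x y; congr (_, _); apply/ffunP => v; rewrite !ffunE /=; case: (v \in C).
have margM X Y : marg mu X s * marg mu Y s =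
    \sum_(x | agree X s x.1 && agree Y s x.2) mu x.1 * mu x.2.
  rewrite /marg mulr_suml.
  under eq_bigr do rewrite mulr_sumr.
  by rewrite pair_big.
rewrite !margM (reindex_inj (inv_inj hK)) /=.
apply: eq_big => [[x y]|[x y]] /=.
  have CB v : v \in C -> v \in B = false by move=> Cv; rewrite (disjointFl disBC).
  apply/andP/andP => -[/agreeP ex /agreeP ey]; split; apply/agreeP => v.
  - move=> Av; case: (boolP (v \in C)) => Cv.
      by have := ex v; rewrite !inE Av ffunE Cv => /(_ isT).
    have Bv : v \in B by apply: contraNT Cv => nBv; apply: (subsetP sAB);
      rewrite inE nBv.
    by have := ey v; rewrite inE Av Bv ffunE (negbTE Cv) => /(_ isT).
  - move=> Bv; have Cv : v \in C = false by rewrite (disjointFr disBC).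
    by have := ex v; rewrite !inE Bv orbT ffunE Cv => /(_ isT).
  - move=> ABv; rewrite ffunE; case: (boolP (v \in C)) => Cv.
      by apply: ex; move: ABv; rewrite inE CB// orbF.
    apply: ey; apply: contraNT Cv => nBv; apply: (subsetP sAB); rewrite inE nBv.
    by move: ABv; rewrite inE (negbTE nBv) orbF.
  - rewrite inE => /andP[Av Bv]; rewrite ffunE (disjointFr disBC)//.
    exact: ex.
move=> /andP[/agreeP ex /agreeP ey]; apply: potts_glue; apply/agreeP => v bv.
have := subsetP sbd v bv; rewrite inE => /andP[Av Bv].
have nCv : v \in C = false by rewrite (disjointFr disBC).
have := ex v; have := ey v; rewrite !inE Av Bv !ffunE nCv /= => /(_ isT) <- /(_ isT) <-.
by [].
Qed.

End PottsMeasure.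

(** * Marginal bounds and isolated vertices *)

Section PottsRegularity.

Variables (R : realType) (V : finType) (q : nat) (beta M : R) (E : {set {set V}}).
Implicit Types (s t u : {ffun V -> 'I_q}) (A B C L T : {set V}) (e : {set V}).

Hypotheses (q_gt0 : (0 < q)%N) (graphE : simple_graph E).
Hypotheses (beta_ge0 : 0 <= beta) (degree_le : beta * (max_degree E)%:R <= M).

Local Notation mu := (@potts R V q beta E).

(** Only the edges at [v] are affected, and there are at most [max_degree E]. *)
Lemma potts_update_le s v a : mu s <= expR M * mu (update s v a).
Proof.
rewrite !pottsE mulrA ler_pM2r ?invr_gt0 ?partition_function_gt0//.
pose c e : R := if v \in e then expR beta else 1.
apply: (@le_trans _ _ ((\prod_(e in E) c e) * potts_weight beta E (update s v a))).
  rewrite -big_split/=; apply: ler_prod => e _; rewrite expR_ge0/= /c.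
  case: (boolP (v \in e)) => ve.
    apply: (@le_trans _ _ (expR beta)).
      by rewrite ler_expR ler_piMr// lern1 leq_b1.
    by rewrite ler_peMr ?expR_ge0// -[X in X <= _]expR0 ler_expR mulr_ge0.
  rewrite mul1r (@monochromatic_agree _ _ s (update s v a))//.
  apply/agreeP => w ew; rewrite ffunE ifN//.
  by apply: contraNneq ve => <-.
rewrite ler_pM2r ?potts_weight_gt0//.
have -> : \prod_(e in E) c e = expR beta ^+ degree E v.
  rewrite -prodr_const [RHS]big_mkcond [LHS]big_mkcond; apply: eq_bigr => e _.
  by rewrite inE /c; case: (e \in E).
rewrite -expRM_natl ler_expR mulrC; apply: le_trans degree_le.
by rewrite ler_wpM2l// ler_nat; apply: leq_bigmax.
Qed.

(** Sum [potts_update_le] over the [q] possible spins at [v]. *)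
Lemma potts_marginally_bounded : marginally_bounded mu (expR (- M) / q%:R).
Proof.
move=> L v s nLv.
have q0 : 0 < q%:R :> R by rewrite ltr0n.
rewrite expRN mulrAC ler_pdivrMr// mulrC ler_pdivrMr ?expR_gt0//.
rewrite {1}/marg (partition_big (fun t => t v) xpredT)//=.
apply: (@le_trans _ _ (\sum_(a : 'I_q) expR M * marg mu (v |: L) s)); last first.
  by rewrite sumr_const card_ord -[_ *+ _]mulr_natl; rewrite le_eqVlt; apply/orP;
    left; apply/eqP; ring.
apply: ler_sum => a _.
rewrite /marg [X in _ <= _ * X](reindex_onto (fun t => update t v (s v)) (fun t =>
  update t v a))/=; last first.
  move=> t /agreeP st; apply/ffunP => w; rewrite !ffunE.
  by case: eqVneq => // ->; rewrite st// !inE eqxx.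
rewrite mulr_sumr; rewrite [leRHS](eq_bigl (fun t => agree L s t && (t v == a)));
  last first.
  move=> t; congr (_ && _).
    apply/agreeP/agreeP => st w.
      move=> Lw; have := st w; rewrite !inE Lw orbT ffunE => /(_ isT).
      by case: eqVneq => // wv; rewrite -wv Lw in nLv.
    by rewrite !inE ffunE; case: eqVneq => [->//|_ /= /st].
  apply/eqP/eqP => [/ffunP/(_ v)|tv]; first by rewrite !ffunE eqxx.
  by apply/ffunP => w; rewrite !ffunE; case: eqVneq => // ->.
by apply: ler_sum => t _; apply: potts_update_le.
Qed.

Definition isolated (F : {set {set V}}) : {set V} :=
  [set v | [forall e in F, v \notin e]].

(** At most [#|T| * max_degree E] edges have to stay closed. *)
Lemma isolated_prob_ge T n : (#|T| <= n)%N -> 0 <= M ->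
  expR (- M) ^+ n <= \sum_(F : {set {set V}} | (F \subset E) && (T \subset isolated F))
    bernoulli E (1 - expR (- beta)) F.
Proof.
move=> leTn M_ge0.
pose D := [set e in E | ~~ [disjoint T & e]].
have sDE : D \subset E by apply/subsetP => e; rewrite inE => /andP[].
rewrite (eq_bigl (fun F : {set {set V}} => (F \subset E) && [disjoint F & D]));
  last first.
  move=> F; case: (boolP (F \subset E)) => //= sFE.
  apply/subsetP/pred0P => [iso e|dis v Tv] /=.
    apply/negbTE/negP => /andP[Fe]; rewrite inE => /andP[_ /pred0Pn[v /andP[/= Tv ev]]].
    by have := iso v Tv; rewrite inE => /forall_inP/(_ e Fe); rewrite ev.
  rewrite inE; apply/forall_inP => e Fe; apply/negP => ev.
  have := dis e; rewrite /= Fe inE (subsetP sFE)//= => /negbFE/pred0P/(_ v).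
  by rewrite /= Tv ev.
rewrite bernoulli_avoids// opprB addrC subrK -!expRM_natl ler_expR.
rewrite !mulrN lerN2.
have cD : (#|D| <= #|T| * max_degree E)%N.
  have sub : D \subset \bigcup_(v in T) [set e in E | v \in e].
    apply/subsetP => e; rewrite inE => /andP[Ee /pred0Pn[v /andP[/= Tv ev]]].
    by apply/bigcupP; exists v => //; rewrite inE Ee.
  apply: leq_trans (subset_leq_card sub) _.
  apply: leq_trans (card_bigcup_le _ _) _.
  rewrite -sum_nat_const leq_sum// => v _; exact: (leq_bigmax v).
apply: (@le_trans _ _ ((#|T| * max_degree E)%:R * beta)).
  by rewrite ler_wpM2r// ler_nat.
rewrite natrM -mulrA; apply: ler_pM; rewrite ?mulr_ge0 ?ler0n ?ler_nat//.
by rewrite mulrC.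
Qed.

Lemma potts_relent_markov (p : {ffun V -> 'I_q} -> R) :
  (forall s, 0 < p s) -> \sum_s p s = 1 -> markov_supermodular E (relent p mu).
Proof.
move=> p_gt0 sum_p A B C sbd dis sAB.
apply: (relent_supermodular p_gt0 (fun s => potts_gt0 _ _ q_gt0 s) sum_p).
- exact: subsetIl.
- exact: subsetIr.
- by move=> s; apply: (potts_markov beta graphE s sbd dis sAB).
Qed.

End PottsRegularity.

(** * The Swendsen-Wang kernel *)

(** The elements of [D] outside [D'] contribute factors [theta + (1 - theta) = 1]. *)
Lemma bernoulli_restrict (R : realFieldType) (T : finType) (D D' : {set T}) (theta :
  R) (f : {set T} -> R) :
  D' \subset D ->
  \sum_(A : {set T} | A \subset D') bernoulli D' theta A * f A =
  \sum_(F : {set T} | F \subset D) bernoulli D theta F * f (F :&: D').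
Proof.
move=> sD'D.
rewrite [RHS](partition_big (fun F => F :&: D') (fun A => A \subset D'))/=; last first.
  by move=> F _; apply: subsetIr.
apply: eq_bigr => A sAD'.
rewrite (eq_bigr (fun F => bernoulli D theta F * f A));
  last by move=> F /andP[_ /eqP->].
rewrite -mulr_suml; congr (_ * _).
pose a x := if x \in D' then if x \in A then theta else 0 else theta.
pose b x := if x \in D' then if x \in A then 0 else 1 - theta else 1 - theta.
transitivity (\prod_(x in D) (a x + b x)).
  rewrite /bernoulli big_mkcond [RHS](bigID [in D'])/= [X in _ * X]big1 ?mulr1;
    last first.
    by move=> x /andP[_ /negbTE nD'x]; rewrite /a /b nD'x addrC subrK.
  rewrite [RHS]big_mkcond; apply: eq_bigr => x _ /=.
  rewrite /a /b; case: (boolP (x \in D')) => D'x; rewrite ?andbF//.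
  by rewrite (subsetP sD'D)//=; case: ifP; rewrite ?addr0 ?add0r.
rewrite -sum_prod_subsets.
rewrite [LHS](bigID (fun F : {set T} => F :&: D' == A))/= [X in _ + X]big1 ?addr0.
  apply: eq_bigr => F /andP[sFD /eqP FA]; apply: eq_bigr => x _.
  rewrite /a /b -FA inE; case: (x \in F); case: (x \in D') => //.
move=> F /andP[_ FA].
have [x D'x neq] : exists2 x, x \in D' & (x \in F) != (x \in A).
  apply/exists_inP; apply: contraR FA => /exists_inPn H.
  apply/eqP/setP => x; rewrite inE; case: (boolP (x \in D')) => D'x;
    rewrite ?andbT ?andbF.
    by apply/eqP; have := H x D'x; rewrite negbK.
  by apply/esym/negbTE; apply: contra D'x; apply: subsetP.
rewrite (bigD1 x) ?(subsetP sD'D)//= /a /b D'x.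
by move: neq; case: (x \in F); case: (x \in A); rewrite ?mul0r.
Qed.

Section SwendsenWang.

Variables (R : realType) (V : finType) (q : nat) (beta : R) (E : {set {set V}}).
Implicit Types (s t u : {ffun V -> 'I_q}) (A B C F : {set {set V}}) (e : {set V}).

Hypotheses (q_gt0 : (0 < q)%N) (graphE : simple_graph E).

Local Notation mu := (@potts R V q beta E).
Local Notation p := (1 - expR (- beta)).

Definition mono_edges s : {set {set V}} := [set e in E | monochromatic s e].

Definition recolor A t : R :=
  \prod_(C in components A) \sum_(a : 'I_q) q%:R^-1 * ([forall v in C, t v == a])%:R.

Lemma swendsen_wangE s t : swendsen_wang beta E s t =
  \sum_(A : {set {set V}} | A \subset mono_edges s)
    bernoulli (mono_edges s) p A * recolor A t.
Proof. by []. Qed.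

Lemma mono_edges_sub s : mono_edges s \subset E.
Proof. by apply/subsetP => e; rewrite inE => /andP[]. Qed.

(** The edges are opened before the spins are consulted, so that the open set is
    independent of the configuration. *)
Lemma swendsen_wang_percolation s t : swendsen_wang beta E s t =
  \sum_(F : {set {set V}} | F \subset E)
    bernoulli E p F * recolor (F :&: mono_edges s) t.
Proof.
by rewrite swendsen_wangE (bernoulli_restrict _ (fun A => recolor A t) (mono_edges_sub s)).
Qed.

Definition linked A : rel V := [rel u v | [set u; v] \in A].

Lemma linked_connect_sym A : connect_sym (linked A).
Proof. by apply: sym_connect_sym => u v; rewrite /linked /= setUC. Qed.

Lemma components_partition A : partition (components A) setT.
Proof.
apply: equivalence_partitionP => x y z _ _ _; split; first exact: connect0.
by move=> xy; apply/idP/idP; apply: connect_trans; rewrite // linked_connect_sym.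
Qed.

(** Expanding the product over components gives a sum over assignments [f] of spins
    to components, and each [f] is realized by exactly one configuration. *)
Lemma sum_recolor A : \sum_t recolor A t = 1.
Proof.
have /and3P[/eqP cov triv n0] := components_partition A.
have [a0 _] : exists a : 'I_q, true by exists (Ordinal q_gt0).
have sumq : \sum_(a : 'I_q) q%:R^-1 = 1 :> R.
  by rewrite sumr_const card_ord -[_ *+ _]mulr_natl divff// pnatr_eq0 -lt0n.
rewrite /recolor.
under eq_bigr do rewrite (big_distr_big a0).
rewrite exchange_big/=.
transitivity (\sum_(f in pffun_on a0 [in components A] (@predT 'I_q))
   \prod_(C in components A) (q%:R^-1 : R)); last first.
  rewrite -(big_distr_big a0 [in components A] predT (fun _ _ => q%:R^-1)).
  by rewrite big1.
apply: eq_bigr => f _.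
under eq_bigr do rewrite big_split/=.
rewrite -mulr_sumr -[RHS]mulr1; congr (_ * _).
pose tf : {ffun V -> 'I_q} := [ffun v => f (pblock (components A) v)].
have pbV v : v \in cover (components A) by rewrite cov inE.
rewrite (bigD1 tf)//= [X in X + _]big1 ?[X in _ + X]big1 ?addr0//.
  move=> t ntf.
  have [v nv] : exists v, t v != tf v.
    by apply/existsP; rewrite -negb_forall; apply: contra ntf => /eqfunP H;
      apply/eqP/ffunP.
  have Cv : pblock (components A) v \in components A by rewrite pblock_mem.
  rewrite (bigD1 _ Cv)/= (_ : [forall _ in _, _] = false) ?mul0r//.
  apply/negbTE/negP => /forall_inP/(_ v); rewrite mem_pblock pbV => /(_ isT).
  by apply/negP; move: nv; rewrite ffunE.
move=> C CA; rewrite (_ : [forall _ in _, _])//.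
apply/forall_inP => v Cv; rewrite ffunE; apply/eqP; congr (f _).
exact: def_pblock.
Qed.

Lemma monochromatic_connect A t x y : A \subset mono_edges t ->
  connect (linked A) x y -> t x = t y.
Proof.
move=> sAt /connectP[pth]; elim: pth x => [|z pth IH] x /=; first by move=> _ ->.
move=> /andP[Axz path_z] lasty; rewrite -(IH z path_z lasty).
have := subsetP sAt _ Axz; rewrite inE => /andP[_ /forall_inP/(_ x)].
rewrite !inE eqxx => /(_ isT)/forall_inP/(_ z).
by rewrite !inE eqxx orbT => /(_ isT)/eqP.
Qed.

Lemma recolorE A t : A \subset E -> recolor A t =
  (A \subset mono_edges t)%:R * \prod_(C in components A) q%:R^-1.
Proof.
move=> sAE.
have inC x : x \in [set y in [set: V] | connect (linked A) x y] by rewrite !inE connect0.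
case: (boolP (A \subset mono_edges t)) => [sAt|].
  rewrite mul1r; apply: eq_bigr => C /imsetP[x _ ->].
  rewrite (bigD1 (t x))//= big1 ?addr0.
    rewrite (_ : [forall _ in _, _]) ?mulr1//.
    apply/forall_inP => y; rewrite !inE /= => xy.
    by rewrite (monochromatic_connect sAt xy).
  move=> a nax; rewrite (_ : [forall _ in _, _] = false) ?mulr0//.
  by apply/negbTE/negP => /forall_inP/(_ x (inC x)); rewrite eq_sym (negbTE nax).
move=> /subsetPn[e Ae]; rewrite inE (subsetP sAE)//= => nmono.
have /eqP/cards2P[x [y [_ eE]]] := graphE (subsetP sAE _ Ae).
have nxy : t x != t y.
  apply: contra nmono => /eqP txy; apply/forall_inP => u; rewrite eE !inE => eu.
  apply/forall_inP => v; rewrite !inE.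
  by case/orP: eu => /eqP-> /orP[]/eqP->; rewrite ?txy.
pose C := [set z in [set: V] | connect (linked A) x z].
have CA : C \in components A by apply/imsetP; exists x.
rewrite mul0r /recolor (bigD1 C)//= big1 ?mul0r// => a _.
rewrite (_ : [forall _ in _, _] = false) ?mulr0//.
apply/negbTE/negP => /forall_inP H.
have /eqP xa := H x (inC x).
have /eqP ya : t y == a by apply: H; rewrite !inE connect1 // /linked /= -eE.
by rewrite xa ya eqxx in nxy.
Qed.

Lemma swendsen_wang_rowsum s : \sum_t swendsen_wang beta E s t = 1.
Proof.
under eq_bigr do rewrite swendsen_wang_percolation.
rewrite exchange_big/= -[RHS](bernoulli_sum E p); apply: eq_bigr => F _.
by rewrite -mulr_sumr sum_recolor mulr1.
Qed.

(** The joint weight of Edwards and Sokal: an edge in [A] contributes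
    [expR beta * (1 - expR (- beta)) = expR beta - 1], a monochromatic edge outside [A]
    contributes [expR beta * expR (- beta) = 1]. The result is symmetric in [s] and
    [t], whence reversibility. *)
Lemma swendsen_wang_weightE s t :
  potts_weight beta E s * swendsen_wang beta E s t =
  \sum_(A : {set {set V}} | (A \subset mono_edges s) && (A \subset mono_edges t))
    (expR beta - 1) ^+ #|A| * \prod_(C in components A) q%:R^-1.
Proof.
rewrite swendsen_wangE mulr_sumr big_mkcondr/=; apply: eq_bigr => A sAs.
rewrite recolorE; last exact: subset_trans (mono_edges_sub s).
case: ifP => _; last by rewrite mul0r !mulr0.
rewrite mul1r mulrA; congr (_ * _).
have -> : potts_weight beta E s = \prod_(e in mono_edges s) expR beta.
  rewrite /potts_weight [LHS]big_mkcond [RHS]big_mkcond; apply: eq_bigr => e _.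
  by rewrite inE; case: (e \in E) => //=; case: (monochromatic s e);
    rewrite ?mulr1 ?mulr0 ?expR0.
rewrite /bernoulli -big_split/= (bigID [in A])/= [X in _ * X]big1 ?mulr1.
  rewrite (eq_bigl [in A]); last first.
    by move=> e /=; case: (boolP (e \in A)) => [/(subsetP sAs) ->|]; rewrite ?andbF.
  by rewrite -prodr_const; apply: eq_bigr => e ->; rewrite mulrBr mulr1 expRxMexpNx_1.
by move=> e /andP[_ /negbTE->]; rewrite opprB addrC subrK expRxMexpNx_1.
Qed.

Lemma swendsen_wang_reversible s t :
  mu s * swendsen_wang beta E s t = mu t * swendsen_wang beta E t s.
Proof.
rewrite !pottsE ![_ / _ * _]mulrAC !swendsen_wang_weightE.
by congr (_ / _); apply: eq_bigl => A; rewrite andbC.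
Qed.

Lemma swendsen_wang_stationary t : \sum_s mu s * swendsen_wang beta E s t = mu t.
Proof.
under eq_bigr do rewrite swendsen_wang_reversible.
by rewrite -mulr_sumr swendsen_wang_rowsum mulr1.
Qed.

Lemma recolor_ge0 A t : 0 <= recolor A t.
Proof.
by apply: prodr_ge0 => C _; apply: sumr_ge0 => a _; rewrite mulr_ge0// invr_ge0.
Qed.

Lemma swendsen_wang_gt0 s t : 0 < beta -> 0 < swendsen_wang beta E s t.
Proof.
move=> beta_gt0; have b1 : 0 < expR (- beta) <= 1.
  by rewrite expR_gt0 expR_le1 oppr_le0 ltW.
have /andP[b_gt0 b_le1] := b1.
rewrite swendsen_wangE (bigD1 set0) ?sub0set//=.
apply: ltr_pwDl.
  rewrite recolorE ?sub0set// mul1r mulr_gt0//.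
    by apply: prodr_gt0 => e _; rewrite inE opprB addrC subrK.
  by apply: prodr_gt0 => C _; rewrite invr_gt0 ltr0n.
apply: sumr_ge0 => A _; rewrite mulr_ge0 ?recolor_ge0//.
by apply: bernoulli_ge0; rewrite subr_ge0 b_le1 lerBlDr lerDl ltW.
Qed.

End SwendsenWang.

(** * Entropy decay in one step *)

Section EntropyDecay.

Variables (R : realType) (V : finType) (q : nat) (beta : R) (E : {set {set V}}).
Implicit Types (s t u : {ffun V -> 'I_q}) (F : {set {set V}}).

Hypotheses (q_gt0 : (0 < q)%N) (graphE : simple_graph E) (beta_gt0 : 0 < beta).

Local Notation mu := (@potts R V q beta E).
Local Notation sw := (@swendsen_wang R V q beta E).
Local Notation p := (1 - expR (- beta)).

Let mu_gt0 s : 0 < mu s. Proof. exact: potts_gt0. Qed.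
Let sum_mu : \sum_s mu s = 1. Proof. exact: sum_potts. Qed.

Lemma edge_prob_bounds : 0 <= p <= 1.
Proof.
by rewrite subr_ge0 expR_le1 oppr_le0 ltW//= lerBlDr lerDl expR_ge0.
Qed.

Definition sw_step (nu : {ffun V -> 'I_q} -> R) t : R := \sum_s nu s * sw s t.

(** The open edges avoid the isolated vertices. *)
Lemma recolor_depends F t :
  depends_on (~: isolated F) (fun s => recolor R (F :&: mono_edges E s) t).
Proof.
move=> s s' agr; suff -> : F :&: mono_edges E s = F :&: mono_edges E s' by [].
apply/setP => e; rewrite !inE.
case: (boolP (e \in F)) => //= Fe; congr (_ && _).
apply: monochromatic_agree; apply: agree_sub agr; apply/subsetP => v ev.
rewrite !inE; apply/forall_inP => H; by have := H e Fe; rewrite ev.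
Qed.

(** The log-sum inequality over the pairs formed by an open set [F] and a
    configuration [s]. The reference weight attached to such a pair is its weight
    under [nu] divided by the density [rho F s] of the spins outside
    [isolated F]; since recolouring depends on these spins only, the reference
    weights sum to the stationary measure. *)
Lemma relent_sw_step_le (nu : {ffun V -> 'I_q} -> R) :
  (forall s, 0 < nu s) -> \sum_s nu s = 1 ->
  relent (sw_step nu) mu setT <=
  \sum_(F : {set {set V}} | F \subset E)
    bernoulli E p F * relent nu mu (~: isolated F).
Proof.
move=> nu_gt0 sum_nu.
have sw_gt0 s t : 0 < sw s t by apply: swendsen_wang_gt0.
have step_gt0 t : 0 < sw_step nu t.
  have [s0 _] : exists s : {ffun V -> 'I_q}, true by exists [ffun=> Ordinal q_gt0].
  rewrite /sw_step (bigD1 s0)//= ltr_wpDr ?mulr_gt0//.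
  by apply: sumr_ge0 => s _; rewrite mulr_ge0 ?ltW.
pose w F := bernoulli E p F.
pose rho F s := density nu mu (~: isolated F) s.
have rho_gt0 F s : 0 < rho F s by apply: density_gt0.
pose K F s t := recolor R (F :&: mono_edges E s) t.
have wK_ge0 F s t : 0 <= w F * K F s t.
  by rewrite mulr_ge0 ?recolor_ge0 ?bernoulli_ge0 ?edge_prob_bounds.
have swE s t : sw s t = \sum_(F : {set {set V}} | F \subset E) w F * K F s t.
  exact: swendsen_wang_percolation.
have sum_muK t : \sum_(F : {set {set V}} | F \subset E)
    \sum_s w F * K F s t * nu s / rho F s = mu t.
  rewrite -[RHS](swendsen_wang_stationary beta q_gt0 graphE t).
  under [RHS]eq_bigr do rewrite swE mulr_sumr.
  rewrite [RHS]exchange_big; apply: eq_bigr => F _.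
  transitivity (w F * \sum_s nu s * (density mu nu (~: isolated F) s * K F s t)).
    rewrite mulr_sumr; apply: eq_bigr => s _.
    by rewrite /rho /density invf_div; ring.
  rewrite (change_of_measure mu nu_gt0 (@recolor_depends F t)).
  by rewrite mulr_sumr; apply: eq_bigr => s _; rewrite /K; ring.
rewrite relentT.
apply: (@le_trans _ _ (\sum_t \sum_(F : {set {set V}} | F \subset E)
    \sum_s w F * K F s t * (nu s * ln (rho F s)))); last first.
  rewrite exchange_big; apply: ler_sum => F _.
  rewrite exchange_big /relent mulr_sumr; apply: ler_sum => s _.
  by rewrite -mulr_suml -mulr_sumr sum_recolor// mulr1.
apply: ler_sum => t _.
set x := sw_step nu t / mu t.
have x_gt0 : 0 < x by rewrite divr_gt0.
have E1 : sw_step nu t = \sum_(F : {set {set V}} | F \subset E)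
    \sum_s w F * K F s t * nu s.
  rewrite /sw_step; under eq_bigr do rewrite swE mulr_sumr.
  rewrite exchange_big; apply: eq_bigr => F _.
  by apply: eq_bigr => s _; ring.
rewrite -subr_ge0.
have -> : \sum_(F : {set {set V}} | F \subset E) \sum_s w F * K F s t * (nu s * ln (rho F s))
    - sw_step nu t * ln x =
  \sum_(F : {set {set V}} | F \subset E) \sum_s w F * K F s t * (nu s * ln (rho F s / x)).
  rewrite E1 mulr_suml -sumrB; apply: eq_bigr => F _.
  rewrite mulr_suml -sumrB; apply: eq_bigr => s _.
  by rewrite ln_div ?posrE//; ring.
apply: (@le_trans _ _ (\sum_(F : {set {set V}} | F \subset E)
    \sum_s w F * K F s t * (nu s * (1 - x / rho F s)))).
  have -> : \sum_(F : {set {set V}} | F \subset E)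
    \sum_s w F * K F s t * (nu s * (1 - x / rho F s)) = sw_step nu t - x * mu t.
    rewrite E1 -sum_muK mulr_sumr -sumrB; apply: eq_bigr => F _.
    by rewrite mulr_sumr -sumrB; apply: eq_bigr => s _; ring.
  by rewrite /x divfK ?subrr// gt_eqF.
apply: ler_sum => F _; apply: ler_sum => s _.
rewrite ler_wpM2l// ler_wpM2l ?(ltW (nu_gt0 s))//.
by have := ln_ge1BV (divr_gt0 (rho_gt0 F s) x_gt0); rewrite invf_div.
Qed.

Variables (M eta theta : R) (K k : nat).
Hypotheses (degree_le : beta * (max_degree E)%:R <= M) (eta_ge0 : 0 <= eta).
Hypothesis K_ge : 4 * eta / (expR (- M) / q%:R) <= K%:R.
Hypothesis SI : spectrally_independent mu eta.
Hypotheses (theta01 : 0 <= theta <= 1)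
  (theta_small : (#|V| * (k * max_degree E) ^ k)%:R * theta ^+ k.+1 <= theta ^+ K.+1 / 2).

Definition decay_rate : R :=
  (theta ^+ K.+1 / 2) * (expR (- M) ^+ K.+1 / k%:R ^+ K.+1).

(** The isolated vertices of the percolation, weighted by its law, satisfy the
    hypotheses of [isolated_gain], with [g] the relative entropies of marginals. *)
Lemma relent_sw_step_contract (nu : {ffun V -> 'I_q} -> R) :
  (forall s, 0 < nu s) -> \sum_s nu s = 1 ->
  relent (sw_step nu) mu setT <= (1 - decay_rate) * relent nu mu setT.
Proof.
move=> nu_gt0 sum_nu; apply: le_trans (relent_sw_step_le nu_gt0 sum_nu) _.
have M_ge0 : 0 <= M by apply: le_trans degree_le; rewrite mulr_ge0// ltW.
have b_gt0 : 0 < expR (- M) / q%:R by rewrite divr_gt0 ?expR_gt0// ltr0n.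
have b_le1 : expR (- M) / q%:R <= 1.
  rewrite ler_pdivrMr ?ltr0n// mul1r; apply: (@le_trans _ _ 1).
    by rewrite expR_le1 oppr_le0.
  by rewrite ler1n.
have super : weakly_supermodular K (relent nu mu).
  apply: (weakly_supermodular_relent nu_gt0 mu_gt0 sum_nu eta_ge0 b_gt0 b_le1 _ _ K_ge).
    exact: spectral_covariance_bounded.
  exact: (potts_marginally_bounded q_gt0 (ltW beta_gt0) degree_le).
have mono := relent_mono nu_gt0 mu_gt0.
pose wt F := if F \subset E then bernoulli E p F else 0.
have wt_ge0 F : 0 <= wt F.
  by rewrite /wt; case: ifP => // _; rewrite bernoulli_ge0 ?edge_prob_bounds.
have iso (T : {set V}) : (#|T| <= K.+1)%N ->
    expR (- M) ^+ K.+1 <= \sum_(F | T \subset isolated F) wt F.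
  move=> /(isolated_prob_ge (ltW beta_gt0) degree_le) /(_ M_ge0) /le_trans; apply.
  by rewrite -big_mkcondl.
have := isolated_gain super mono (potts_relent_markov beta q_gt0 graphE nu_gt0 sum_nu)
  wt_ge0 iso (exprn_ge0 _ (expR_ge0 _)) theta01 theta_small.
rewrite -/decay_rate relent0// subr0 => gain.
rewrite big_mkcond/= (eq_bigr (fun F => wt F * relent nu mu (~: isolated F)));
  last first.
  by move=> F _; rewrite /wt; case: ifP; rewrite ?mul0r.
have sum_wt : \sum_F wt F = 1.
  by rewrite -big_mkcond bernoulli_sum.
have -> : \sum_F wt F * relent nu mu (~: isolated F) = relent nu mu setT -
    \sum_F wt F * (relent nu mu setT - relent nu mu (~: isolated F)).
  rewrite -{1}[relent nu mu setT]mul1r -sum_wt mulr_suml -sumrB.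
  by apply: eq_bigr => F _; ring.
by rewrite mulrBl mul1r lerD2l lerN2.
Qed.

End EntropyDecay.

(** * From entropy to total variation *)

(** A Pinsker-type bound. Write [y] for the square root of the density; then
    [`|y ^+ 2 - 1| <= 4 * (y - 1) ^+ 2 + 8^-1 * (y ^+ 2 + 1)], and the first square is
    controlled by [xlnx_ge_hellinger]. *)
Lemma tv_dist_relent (R : realType) (V S : finType) (p q : {ffun V -> S} -> R) :
  (forall s, 0 < p s) -> (forall s, 0 < q s) ->
  \sum_s p s = 1 -> \sum_s q s = 1 ->
  relent p q setT <= 16^-1 -> tv_dist p q <= 4^-1.
Proof.
move=> p_gt0 q_gt0 sum_p sum_q small.
have pointwise s : `|p s - q s| <=
    4 * (p s * ln (p s / q s) - p s + q s) + 8^-1 * (p s + q s).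
  have x_gt0 : 0 < p s / q s by rewrite divr_gt0.
  have := xlnx_ge_hellinger x_gt0.
  have y_ge0 := sqrtr_ge0 (p s / q s); have := sqr_sqrtr (ltW x_gt0).
  move: (Num.sqrt _) y_ge0 => y y_ge0 y2 hy.
  have pE : p s = q s * y ^+ 2 by rewrite y2 mulrC divfK// gt_eqF.
  have -> : p s * ln (p s / q s) - p s + q s =
      q s * (p s / q s * ln (p s / q s) - p s / q s + 1).
    by field; rewrite gt_eqF.
  have hy' : q s * (y - 1) ^+ 2 <=
      q s * (p s / q s * ln (p s / q s) - p s / q s + 1).
    by rewrite ler_wpM2l ?(ltW (q_gt0 s)).
  apply: (@le_trans _ _ (q s * (4 * (y - 1) ^+ 2 + 8^-1 * (y ^+ 2 + 1)))).
    have -> : p s - q s = q s * (y ^+ 2 - 1) by rewrite pE; ring.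
    rewrite normrM gtr0_norm// ler_wpM2l ?(ltW (q_gt0 s))//.
    have a1 := sqr_ge0 (y - 1); have a2 := sqr_ge0 (8 * (y - 1) - (y + 1)).
    have a3 := sqr_ge0 (8 * (y - 1) + (y + 1)).
    by rewrite ler_norml; apply/andP; split; nra.
  have pqE : p s + q s = q s * (y ^+ 2 + 1) by rewrite pE; ring.
  rewrite pqE; move: hy'; set W := q s * (_ - _ + 1); lra.
rewrite /tv_dist.
apply: (@le_trans _ _ (2^-1 * \sum_s (4 * (p s * ln (p s / q s) - p s + q s) + 8^-1 *
  (p s + q s)))).
  by rewrite ler_wpM2l ?invr_ge0//; apply: ler_sum => s _; apply: pointwise.
rewrite big_split/= -!mulr_sumr !big_split/= sumrN -relentT sum_p sum_q.
lra.
Qed.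

Section Mixing.

Variables (R : realType) (V : finType) (q : nat) (beta : R) (E : {set {set V}}).
Implicit Types (s t : {ffun V -> 'I_q}).

Hypotheses (q_gt0 : (0 < q)%N) (graphE : simple_graph E) (beta_gt0 : 0 < beta).

Local Notation mu := (@potts R V q beta E).
Local Notation sw := (@swendsen_wang R V q beta E).

Lemma kernel_powSr (T : finType) (P : T -> T -> R) n x y :
  kernel_pow P n.+1 x y = \sum_z kernel_pow P n x z * P z y.
Proof.
elim: n x => [|n IHn] x.
  rewrite /= (bigD1 y)//= eqxx mulr1 big1 ?addr0; last first.
    by move=> z /negbTE zy; rewrite zy mulr0.
  rewrite (bigD1 x)//= eqxx mul1r big1 ?addr0// => z.
  by rewrite eq_sym => /negbTE zx; rewrite zx mul0r.
transitivity (\sum_w P x w * kernel_pow P n.+1 w y); first by [].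
under eq_bigr do rewrite IHn mulr_sumr.
rewrite exchange_big; apply: eq_bigr => z _.
by rewrite /= mulr_suml; apply: eq_bigr => w _; rewrite mulrA.
Qed.

(** Entropy estimates need strictly positive laws; from any starting point one step
    is enough, since with positive probability no edge is kept. *)
Lemma kernel_pow_sw s n : [/\ forall t, 0 < kernel_pow sw n.+1 s t &
  \sum_t kernel_pow sw n.+1 s t = 1].
Proof.
have sw_gt0 := swendsen_wang_gt0 q_gt0 graphE _ _ beta_gt0.
elim: n => [|n [IHpos IHsum]].
  have E1 t : kernel_pow sw 1 s t = sw s t.
    rewrite kernel_powSr (bigD1 s)//= eqxx mul1r big1 ?addr0// => z.
    by rewrite eq_sym => /negbTE ->; rewrite mul0r.
  split=> [t|]; first by rewrite E1.
  by under eq_bigr do rewrite E1; rewrite swendsen_wang_rowsum.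
split=> [t|].
  rewrite kernel_powSr (bigD1 s)//; apply: ltr_pwDl; first by rewrite mulr_gt0.
  by apply: sumr_ge0 => z _; rewrite mulr_ge0// ltW.
under eq_bigr do rewrite kernel_powSr.
rewrite exchange_big -[RHS]IHsum; apply: eq_bigr => z _.
by rewrite -mulr_sumr swendsen_wang_rowsum// mulr1.
Qed.

Variable M : R.
Hypothesis degree_le : beta * (max_degree E)%:R <= M.

Lemma card_edges_le : (#|E| <= #|V| * max_degree E)%N.
Proof.
have sub : E \subset \bigcup_v [set e in E | v \in e].
  apply/subsetP => e Ee; have : e != set0 by rewrite -card_gt0 (graphE Ee).
  by move=> /set0Pn[v ev]; apply/bigcupP; exists v => //; rewrite inE Ee.
apply: leq_trans (subset_leq_card sub) _.
apply: leq_trans (card_bigcup_le _ _) _.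
rewrite -sum_nat_const; apply: leq_sum => v _; exact: (leq_bigmax v).
Qed.

(** Every weight is at least 1, and the partition function is at most
    [q ^+ n * expR (n * M)] because there are at most [n * max_degree E] edges. *)
Lemma ln_inv_potts_le s : ln (mu s)^-1 <= #|V|%:R * (q%:R + M).
Proof.
have w_ge1 : 1 <= potts_weight beta E s.
  rewrite -expR_hamiltonian -[X in X <= _]expR0 ler_expR /hamiltonian mulNr opprK.
  by rewrite mulr_ge0 ?(ltW beta_gt0)// sumr_ge0.
have w_le t : potts_weight beta E t <= expR (#|V|%:R * M).
  apply: (@le_trans _ _ (\prod_(e in E) expR beta)).
    apply: ler_prod => e _; rewrite expR_ge0 ler_expR ler_piMr ?(ltW beta_gt0)//.
    by rewrite lern1 leq_b1.
  rewrite prodr_const -expRM_natl ler_expR.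
  apply: (@le_trans _ _ ((#|V| * max_degree E)%:R * beta)).
    by rewrite ler_pM2r// ler_nat card_edges_le.
  by rewrite natrM -mulrA ler_wpM2l// mulrC.
have Z_le : partition_function q beta E <= q%:R ^+ #|V| * expR (#|V|%:R * M).
  rewrite partition_functionE;
    apply: (@le_trans _ _ (\sum_(t : {ffun V -> 'I_q}) expR (#|V|%:R * M))).
    by apply: ler_sum => t _.
  by rewrite sumr_const card_ffun card_ord -[_ *+ _]mulr_natl natrX.
have q0 : 0 < q%:R :> R by rewrite ltr0n.
rewrite pottsE invf_div.
have Z_gt0 := partition_function_gt0 beta E q_gt0.
apply: (@le_trans _ _ (ln (q%:R ^+ #|V| * expR (#|V|%:R * M)))).
  rewrite ler_ln ?posrE ?divr_gt0 ?mulr_gt0 ?exprn_gt0 ?expR_gt0 ?potts_weight_gt0//.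
  apply: le_trans Z_le; rewrite ler_pdivrMr ?potts_weight_gt0//.
  by rewrite ler_peMr// ltW.
rewrite lnM ?posrE ?exprn_gt0 ?expR_gt0// expRK lnXn// mulrDr lerD2r.
by rewrite -[_ *+ _]mulr_natl ler_wpM2l// ltW// ln_sublinear.
Qed.

Variables (delta : R).
Hypothesis delta_le1 : delta <= 1.
Hypothesis contract : forall nu : {ffun V -> 'I_q} -> R,
  (forall s, 0 < nu s) -> \sum_s nu s = 1 ->
  relent (sw_step beta E nu) mu setT <= (1 - delta) * relent nu mu setT.

Lemma relent_kernel_pow_le s n :
  relent (kernel_pow sw n.+1 s) mu setT <= (1 - delta) ^+ n * (#|V|%:R * (q%:R + M)).
Proof.
elim: n => [|n IHn].
  have [nu_gt0 sum_nu] := kernel_pow_sw s 0.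
  move: (kernel_pow sw 1 s) nu_gt0 sum_nu => nu nu_gt0 sum_nu.
  rewrite expr0 mul1r relentT -[leRHS]mul1r -[X in _ <= X * _]sum_nu mulr_suml.
  apply: ler_sum => t _; rewrite ler_wpM2l ?(ltW (nu_gt0 t))//.
  apply: (le_trans _ (ln_inv_potts_le t)).
  have mu_gt0 : 0 < mu t by apply: potts_gt0.
  rewrite ler_ln ?posrE; [|by rewrite divr_gt0 ?nu_gt0|by rewrite invr_gt0].
  rewrite ler_piMl ?invr_ge0 ?(ltW mu_gt0)//.
  rewrite -sum_nu (bigD1 t)//= lerDl; apply: sumr_ge0 => z _; exact: ltW.
have [nu_gt0 sum_nu] := kernel_pow_sw s n.
rewrite exprS -mulrA; apply: (le_trans _ (ler_wpM2l _ IHn)); last by rewrite subr_ge0.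
apply: (le_trans _ (contract nu_gt0 sum_nu)); rewrite le_eqVlt; apply/orP; left;
  apply/eqP.
rewrite !relentT; apply: eq_bigr => t _.
by rewrite (_ : kernel_pow sw n.+2 s t = sw_step beta E (kernel_pow sw n.+1 s) t)//;
  exact: kernel_powSr.
Qed.

Lemma mixed_at_contract n :
  (1 - delta) ^+ n * (#|V|%:R * (q%:R + M)) <= 16^-1 -> mixed_at sw mu n.+1.
Proof.
move=> small; apply: bigmax_le => [|s _]; first by rewrite invr_ge0.
have [nu_gt0 sum_nu] := kernel_pow_sw s n.
apply: tv_dist_relent => //.
- by move=> t; apply: potts_gt0.
- exact: sum_potts.
- exact: le_trans (relent_kernel_pow_le s n) small.
Qed.

End Mixing.

(** * Choice of scales and conclusion *)

Lemma max_degree_le_card (V : finType) (E : {set {set V}}) :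
  simple_graph E -> (max_degree E <= #|V|)%N.
Proof.
move=> graphE; apply/bigmax_leqP => v _.
apply: (@leq_trans #|[set [set v; w] | w : V]|); last first.
  by apply: leq_trans (leq_imset_card _ _) _; rewrite max_card.
apply: subset_leq_card; apply/subsetP => e; rewrite inE => /andP[Ee ve].
have /eqP/cards2P[x [y [_ eE]]] := graphE _ Ee.
move: ve; rewrite eE !inE => /orP[]/eqP->; apply/imsetP; first by exists y.
by exists x; rewrite // setUC.
Qed.

(** In the application [r = K.+1], [D] is the maximum degree, [l] is about the binary
    logarithm of [n], and [k = 2 ^ (4 * r + 4) * l] is the cluster size. The factor is
    chosen so that [1 + 3 * r + (4 * r + 4) * r <= 2 ^ (4 * r + 4)], which absorbs
    every power of [2 ^ l] on the left. *)
Lemma cluster_scale_bound (n D l r : nat) : (0 < r)%N -> (0 < l)%N -> (n < 2 ^ l)%N -> (D <= n)%N ->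
  (n * (2 * (2 ^ (4 * r + 4) * l * D)) ^ r <= 2 ^ (2 ^ (4 * r + 4) * l))%N.
Proof.
move=> r_gt0 l_gt0 ltn leD; set j := (4 * r + 4)%N.
have jr : (1 + 3 * r + j * r <= 2 ^ j)%N.
  have := ltn_expl (2 * r + 2) (isT : (1 < 2)%N).
  have -> : (2 ^ j = 2 ^ (2 * r + 2) * 2 ^ (2 * r + 2))%N.
    by rewrite -expnD; congr (2 ^ _)%N; rewrite /j; lia.
  rewrite /j; move: (2 ^ _)%N => z; nia.
have base : (2 * (2 ^ j * l * D) <= 2 ^ (1 + j + 2 * l))%N.
  have -> : (2 ^ (1 + j + 2 * l) = 2 * (2 ^ j * 2 ^ l * 2 ^ l))%N.
    have -> : (2 * l = l + l)%N by rewrite mul2n addnn.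
    by rewrite !expnD expn1 !mulnA.
  have leD2 : (D <= 2 ^ l)%N by apply: leq_trans leD (ltnW ltn).
  by rewrite !leq_mul// ltnW// ltn_expl.
apply: (@leq_trans (2 ^ l * (2 ^ (1 + j + 2 * l)) ^ r)).
  by rewrite leq_mul ?(ltnW ltn)// leq_exp2r.
rewrite -expnM -expnD leq_exp2l//.
apply: (@leq_trans ((1 + 3 * r + j * r) * l)); last by rewrite leq_mul2r jr orbT.
nia.
Qed.

Lemma exists_log_scale (R : realType) (n : nat) : (2 <= n)%N ->
  exists2 l : nat, (0 < l)%N && (n < 2 ^ l)%N & l%:R <= 4 * ln (n%:R : R).
Proof.
move=> n_ge2; have n_gt0 : (0 < n)%N by apply: leq_trans n_ge2.
have half_le (x : R) : 2 <= x -> 2^-1 <= ln x :> R.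
  move=> x_ge2; have x_gt0 : 0 < x by apply: lt_le_trans x_ge2.
  apply: (le_trans _ (ln_ge1BV x_gt0)).
  have : x^-1 <= 2^-1 by rewrite lef_pV2 ?posrE.
  by move: (x^-1) => y; lra.
exists (trunc_log 2 n).+1; first by rewrite /= trunc_log_ltn.
have ln_n : 2^-1 <= ln (n%:R : R) by apply: half_le; rewrite ler_nat.
have : (trunc_log 2 n)%:R * 2^-1 <= ln (n%:R : R).
  apply: (@le_trans _ _ ((trunc_log 2 n)%:R * ln 2)).
    by rewrite ler_wpM2l// half_le.
  rewrite mulr_natl -lnXn// ler_ln ?posrE ?exprn_gt0 ?ltr0n//.
  by rewrite -natrX ler_nat trunc_logP.
move: (trunc_log 2 n) => T h; rewrite -[T.+1%:R]natr1; lra.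
Qed.

Lemma exists_mixing_time (R : realType) (T : finType) (P : T -> T -> R) (mu : T -> R) n :
  mixed_at P mu n.+1 -> exists2 t, is_mixing_time P mu t & (t <= n.+1)%N.
Proof.
move=> mixn.
pose good t := (0 < t)%N && (\big[Num.max/0]_(x : T) tv_dist (kernel_pow P t x) mu <= 4^-1).
have exg : exists t, good t by exists n.+1; rewrite /good /=; exact: mixn.
case: (ex_minnP exg) => t /andP[t_gt0 mixt] mint; exists t.
  by split=> // s s_gt0 mixs; apply: mint; rewrite /good s_gt0; exact: mixs.
by apply: mint; rewrite /good /=; exact: mixn.
Qed.

Lemma exists_decay_steps (R : realType) (delta B : R) :
  0 < delta -> delta <= 1 -> 1 <= 16 * B ->
  exists2 m : nat, (1 - delta) ^+ m * B <= 16^-1 & m%:R <= ln (16 * B) / delta + 1.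
Proof.
move=> d_gt0 d_le1 B_ge1; set X := ln (16 * B) / delta.
have X_ge0 : 0 <= X by rewrite divr_ge0 ?ln_ge0 ?(ltW d_gt0).
have [m_le m_gt] := andP (truncn_itv X_ge0).
exists (Num.truncn X).+1; last by rewrite -[(Num.truncn X).+1%:R]natr1 lerD2r.
set m := (Num.truncn X).+1.
have B_gt0 : 0 < 16 * B by apply: lt_le_trans B_ge1.
have B0 : 0 < B by rewrite pmulr_rgt0 in B_gt0.
have e1 : (1 - delta) ^+ m <= (16 * B)^-1.
  apply: (@le_trans _ _ (expR (- delta) ^+ m)).
    rewrite lerXn2r ?nnegrE ?subr_ge0 ?expR_ge0//.
    exact: expR_ge1Dx.
  rewrite -expRM_natl -[leRHS](lnK (x := (16 * B)^-1)) ?posrE ?invr_gt0//.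
  rewrite ler_expR lnV ?posrE// mulrN lerN2 -ler_pdivrMr//.
  exact: ltW.
apply: le_trans (ler_wpM2r (ltW B0) e1) _.
by rewrite invfM -mulrA mulVf ?mulr1// gt_eqF.
Qed.

(** Here [a] is the product of cluster size and maximum degree, and the density of the
    random set is [(2 * a)^-1]: each additional vertex of a cluster costs a factor at
    most 1/2, and [k] such factors beat both [n] and the loss [(2 * a) ^+ r]. *)
Lemma cluster_density_small (R : realFieldType) (a : R) (n k r : nat) :
  1 <= a -> n%:R * (2 * a) ^+ r <= 2 ^+ k ->
  n%:R * a ^+ k * (2 * a)^-1 ^+ k.+1 <= (2 * a)^-1 ^+ r / 2.
Proof.
move=> a_ge1; have a_gt0 : 0 < a by apply: lt_le_trans a_ge1.
have : 2 <= 2 * a by rewrite ler_peMr.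
move: (2 * a) (exprMn k 2 a) => x xk x_ge2 bnd.
have x_gt0 : 0 < x by apply: lt_le_trans x_ge2.
have xr_gt0 : 0 < x ^+ r by apply: exprn_gt0.
have two_gt0 : 0 < 2 ^+ k :> R by apply: exprn_gt0.
have ak_gt0 : 0 < a ^+ k by apply: exprn_gt0.
have -> : n%:R * a ^+ k * x^-1 ^+ k.+1 = n%:R / (2 ^+ k * x).
  by rewrite exprVn exprSr xk; field; rewrite !gt_eqF.
rewrite exprVn ler_pdivrMr ?mulr_gt0//.
have n_le : n%:R <= 2 ^+ k / x ^+ r by rewrite ler_pdivlMr.
apply: le_trans n_le _.
rewrite [leRHS](_ : _ = (2 ^+ k / x ^+ r) * (x / 2)); last by ring.
by rewrite ler_peMr ?divr_ge0 ?(ltW two_gt0) ?(ltW xr_gt0)// ler_pdivlMr// mul1r.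
Qed.

Theorem theorem1p2 (R : realType) (q : nat) (hq : (2 <= q)%N)
    (etabar M : R) (hetabar : 0 < etabar) (hM : 0 < M) :
  exists c C : R, [/\ 0 < c, 0 < C &
    forall (beta eta : R) (Delta : nat),
      0 < beta -> 0 < eta -> (3 <= Delta)%N ->
      eta <= etabar -> beta * Delta%:R <= M ->
    forall (V : finType) (E : {set {set V}}),
      simple_graph E -> max_degree E = Delta ->
      spectrally_independent (@potts R V q beta E) eta ->
      exists2 t : nat,
        is_mixing_time (@swendsen_wang R V q beta E) (@potts R V q beta E) t &
        t%:R <= C * (Delta%:R * ln (#|V|%:R)) `^ c].
Proof.
have q_gt0 : (0 < q)%N by apply: leq_trans hq.
have q0 : 0 < q%:R :> R by rewrite ltr0n.
pose b : R := expR (- M) / q%:R.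
have b_gt0 : 0 < b by rewrite divr_gt0 ?expR_gt0.
pose K := (Num.truncn (4 * etabar / b)).+1.
have K_ge : 4 * etabar / b <= K%:R.
  have pos : 0 <= 4 * etabar / b.
    by rewrite divr_ge0 ?(ltW b_gt0)// mulr_ge0// ltW.
  by have /andP[_ /ltW] := truncn_itv pos.
pose r := K.+1; pose N : nat := 2 ^ (4 * r + 4).
have N_gt0 : (0 < N)%N by rewrite expn_gt0.
pose Lc : R := q%:R + M.
have Lc_ge2 : 2 <= Lc by rewrite /Lc -[leLHS]addr0 lerD ?(ltW hM)// ler_nat.
(* The constant in the bound ln (16 n (q + M)) / delta <= A * Y ^+ (2 * r + 1) for
   Y = Delta * ln n, using k <= 4 N Y and 2 k Delta <= 8 N Y. *)
pose A : R := 2 * (8 * N%:R) ^+ r * (4 * N%:R) ^+ r * expR M ^+ r * (2 * ln (16 * Lc) + 1).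
have lnL_ge0 : 0 <= ln (16 * Lc) by apply: ln_ge0; lra.
have A_ge0 : 0 <= A.
  have pw (x : R) : 0 <= x -> 0 <= x ^+ r by exact: exprn_ge0.
  have l_ge0 : 0 <= 2 * ln (16 * Lc) + 1 by rewrite addr_ge0// mulr_ge0.
  apply: mulr_ge0 l_ge0; apply: mulr_ge0 (pw _ (expR_ge0 _)).
  by apply: mulr_ge0 (pw _ _); [apply: mulr_ge0 (pw _ _)|]; rewrite ?mulr_ge0.
exists (2 * r + 1)%:R, (A + 2); split; first by rewrite ltr0n addn1.
  by rewrite ltr_wpDl.
move=> beta eta Delta beta_gt0 eta_gt0 D_ge3 eta_le bD_le V E graphE DE SI.
have D_le : (Delta <= #|V|)%N by rewrite -DE max_degree_le_card.
set n := #|V| in D_le *.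
have n_ge2 : (2 <= n)%N by apply: leq_trans D_le; apply: leq_trans D_ge3.
have n_gt0 : (0 < n)%N by apply: leq_trans n_ge2.
have [l /andP[l_gt0 ltnl] l_le] := exists_log_scale R n_ge2.
have ln_ge : 2^-1 <= ln (n%:R : R).
  have n_gt0R : 0 < n%:R :> R by rewrite ltr0n.
  apply: (le_trans _ (ln_ge1BV n_gt0R)).
  have : (n%:R : R)^-1 <= 2^-1 by rewrite lef_pV2 ?posrE// ler_nat.
  by move: (n%:R^-1) => y; lra.
pose k := (N * l)%N.
have k_gt0 : (0 < k)%N by rewrite muln_gt0 N_gt0.
have D_gt0 : (0 < Delta)%N by apply: leq_trans D_ge3.
pose a : R := (k * Delta)%:R.
have a_ge1 : 1 <= a by rewrite ler1n muln_gt0 k_gt0.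
have a_gt0 : 0 < a by apply: lt_le_trans a_ge1.
pose theta : R := (2 * a)^-1.
have th_gt0 : 0 < theta by rewrite invr_gt0 mulr_gt0.
have th_le1 : theta <= 1.
  rewrite invf_le1 ?mulr_gt0//; apply: (le_trans a_ge1).
  by rewrite ler_peMl ?(ltW a_gt0)// ler1n.
have th01 : 0 <= theta <= 1 by rewrite (ltW th_gt0).
have th_small : (#|V| * (k * max_degree E) ^ k)%:R * theta ^+ k.+1 <= theta ^+ K.+1 / 2.
  have bnd : n%:R * (2 * a) ^+ r <= 2 ^+ k.
    rewrite /a -natrM -natrX -natrM -natrX ler_nat.
    exact: (cluster_scale_bound (isT : (0 < r)%N) l_gt0 ltnl D_le).
  by rewrite DE natrM natrX; apply: cluster_density_small bnd.
have d_le : beta * (max_degree E)%:R <= M by rewrite DE.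
have KE : 4 * eta / (expR (- M) / q%:R) <= K%:R.
  apply: le_trans K_ge; rewrite ler_wpM2r ?invr_ge0 ?(ltW b_gt0)//.
  by rewrite ler_wpM2l.
pose delta := decay_rate M theta K k.
have contract := relent_sw_step_contract q_gt0 graphE beta_gt0 d_le (ltW eta_gt0) KE
  SI th01 th_small.
have delta_gt0 : 0 < delta.
  by rewrite /delta /decay_rate mulr_gt0 ?divr_gt0 ?exprn_gt0 ?expR_gt0 ?ltr0n.
have delta_le1 : delta <= 1.
  have kr : 1 <= k%:R ^+ K.+1 :> R by rewrite exprn_ege1// ler1n.
  have kr_gt0 : 0 < k%:R ^+ K.+1 :> R by apply: lt_le_trans kr.
  have th_pow : theta ^+ K.+1 <= 1 by rewrite exprn_ile1 ?(ltW th_gt0).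
  have e_pow : expR (- M) ^+ K.+1 <= 1.
    by rewrite exprn_ile1 ?expR_ge0// expR_le1 oppr_le0 ltW.
  rewrite /delta /decay_rate; apply: mulr_ile1.
  - by rewrite divr_ge0// exprn_ge0// ltW.
  - by rewrite divr_ge0 ?(ltW kr_gt0)// exprn_ge0// expR_ge0.
  - by rewrite ler_pdivrMr// mul1r (le_trans th_pow)// ler1n.
  - by rewrite ler_pdivrMr// mul1r (le_trans e_pow).
have B_ge1 : 1 <= 16 * (n%:R * Lc).
  have : 1 * 2 <= n%:R * Lc by apply: ler_pM; rewrite // ler1n.
  by move: (n%:R * Lc) => B hB; clear -hB; lra.
have [m small m_le] := exists_decay_steps delta_gt0 delta_le1 B_ge1.
have mixm := mixed_at_contract q_gt0 graphE beta_gt0 d_le delta_le1 contract small.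
have [t mt t_le] := exists_mixing_time mixm.
exists t => //.
have lnn_ge0 : 0 <= ln (n%:R : R) by apply: le_trans ln_ge; rewrite invr_ge0.
rewrite powR_mulrn; last by rewrite mulr_ge0.
set Y := Delta%:R * ln n%:R.
have Y_ge_ln : ln n%:R <= Y by rewrite ler_peMl// ler1n.
have Y_ge1 : 1 <= Y.
  have : 3 * 2^-1 <= Y.
    by apply: ler_pM => //; rewrite ?invr_ge0// ler_nat.
  by move=> hY; clear -hY; lra.
have Y_ge0 : 0 <= Y by apply: le_trans Y_ge1.
have N_ge0 : 0 <= N%:R :> R by [].
have k_le : k%:R <= 4 * N%:R * Y.
  rewrite /k natrM [4 * _]mulrC -mulrA ler_wpM2l//.
  by apply: le_trans l_le _; rewrite ler_wpM2l.
have a_le : 2 * a <= 8 * N%:R * Y.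
  rewrite /a (natrM R k Delta) /k (natrM R N l) /Y (_ : 8 * N%:R * _ = 2 * (N%:R * (4
    * ln n%:R) * Delta%:R)); last by ring.
  by rewrite ler_wpM2l// ler_wpM2r// ler_wpM2l.
have ln_le : ln (16 * (n%:R * Lc)) <= (2 * ln (16 * Lc) + 1) * Y.
  have L_gt0 : 0 < 16 * Lc by rewrite mulr_gt0// (lt_le_trans _ Lc_ge2).
  rewrite mulrCA [leLHS]lnM ?posrE ?ltr0n//.
  have : ln (16 * Lc) <= 2 * ln (16 * Lc) * Y.
    by rewrite -[leLHS]mulr1; apply: ler_pM => //; rewrite ler_peMl// ler1n.
  move=> h; apply: le_trans (lerD Y_ge_ln h) _.
  by rewrite [leRHS]mulrDl mul1r addrC.
have deltaV : delta^-1 = 2 * (2 * a) ^+ r * k%:R ^+ r * expR M ^+ r.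
  rewrite /delta /decay_rate -/r /theta exprVn expRN exprVn.
  have nz1 : (2 * a) ^+ r != 0 by rewrite gt_eqF// exprn_gt0// mulr_gt0.
  have nz2 : k%:R ^+ r != 0 :> R by rewrite gt_eqF// exprn_gt0// ltr0n.
  have nz3 : expR M ^+ r != 0 by rewrite gt_eqF// exprn_gt0// expR_gt0.
  by move: ((2 * a) ^+ r) (k%:R ^+ r) (expR M ^+ r) nz1 nz2 nz3 => x y z *; field;
    apply/and3P.
have pw_le (x y : R) : 0 <= x -> x <= y -> x ^+ r <= y ^+ r.
  by move=> x_ge0 xy; rewrite lerXn2r ?nnegrE// (le_trans x_ge0).
have pw_ge0 (x : R) : 0 <= x -> 0 <= x ^+ r by exact: exprn_ge0.
have X_le : ln (16 * (n%:R * Lc)) / delta <= A * Y ^+ (2 * r + 1).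
  have -> : A * Y ^+ (2 * r + 1) = ((2 * ln (16 * Lc) + 1) * Y) *
      (2 * (8 * N%:R * Y) ^+ r * (4 * N%:R * Y) ^+ r * expR M ^+ r).
    rewrite /A exprD exprM expr2 expr1 !exprMn.
    move: (_ ^+ r) (_ ^+ r) (_ ^+ r) (_ ^+ r) (_ ^+ r) (ln _); clear; move=> *; ring.
  rewrite deltaV; apply: ler_pM => //.
  - exact: ln_ge0.
  - by rewrite -deltaV invr_ge0 ltW.
  apply: ler_wpM2r; first exact: pw_ge0 (expR_ge0 _).
  have x_ge0 : 0 <= 2 * a by rewrite mulr_ge0// ltW.
  apply: ler_pM; [|exact: pw_ge0|by apply: ler_wpM2l => //; apply: pw_le|exact: pw_le].
  by apply: mulr_ge0 => //; apply: pw_ge0.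
have Yp_ge1 : 1 <= Y ^+ (2 * r + 1) by apply: exprn_ege1.
apply: (@le_trans _ _ (A * Y ^+ (2 * r + 1) + 2)).
  apply: (@le_trans _ _ m.+1%:R); first by rewrite ler_nat.
  rewrite -[m.+1%:R]natr1 (_ : _ + 2 = A * Y ^+ (2 * r + 1) + 1 + 1); last by ring.
  by rewrite lerD2r; apply: le_trans m_le _; rewrite lerD2r.
by rewrite mulrDl lerD2l ler_peMr.
Qed.
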